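(* There is a randomized algorithm whose input consists of a directed $m$-edge $n$-vertex graph $G$ with positive integral weights $w(v) \leq W$ on the vertices $v \in V(G)$, such that $G$ has some vertex-cut, as well as a precision parameter $\epsilon \geq 0$. The algorithm is further given access to a $(1+\epsilon)$-Approximate Rooted Minimum Vertex-Cut oracle on $V(G)$ with the weight function $w$. The output of the algorithm is a vertex-cut $(L,S,R)$ in $G$ such that, with probability at least $\frac{1}{2}$, $w(S) \leq (1+\epsilon)\mathrm{OPT}_{G}$ holds, where $\mathrm{OPT}_{G}$ denotes the weight of the global minimum vertex-cut in $G$. The algorithm makes at most $O\left(m/n\right)$ queries to the oracle, and the overall number of edges in the graphs from these queries is $O(m)$. The algorithm spends at most $\tilde{O}(m \log W)$ time outside of oracle queries.
   Context: Graphs are directed, without self-loops (and without parallel edges unless stated otherwise). A vertex-cut in a directed graph $G$ is an ordered triple $(L,S,R)$ that is a partition of $V(G)$ with $L,R\neq\emptyset$ ($S$ may be empty) and no edge of $G$ from $L$ to $R$; its weight is $w(S)=\sum_{v\in S}w(v)$. The global minimum vertex-cut weight is the minimum weight over all vertex-cuts. Rooted Minimum Vertex-Cut oracle: for a vertex set $V$, a weight function $w$ assigning positive integral weights $w(v)\le W$ to $v\in V$, and $\epsilon\ge 0$, a $(1+\epsilon)$-Approximate Rooted Minimum Vertex-Cut oracle on $V$ with weight function $w$ answers the following query: given any directed graph $G'$ with $V(G')=V$ and any vertex $y^*\in V$ such that some vertex-cut $(L',S',R')$ of $G'$ has $y^*\in R'$, it returns a vertex-cut $(L,S,R)$ of $G'$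 with $y^*\in R$ such that, with probability at least $\frac12$, $w(S)\le(1+\epsilon)\mathrm{OPT}_{G',y^*}$, where $\mathrm{OPT}_{G',y^*}$ is the minimum weight of a vertex-cut $(L',S',R')$ of $G'$ with $y^*\in R'$. The notation $\tilde{O}$ hides $\mathrm{polylog}(m)$ factors. *)

(* Defs.v *)
From HB Require Import structures.
From mathcomp Require Import all_boot all_order all_algebra.
From mathcomp Require Import reals.
Set Implicit Arguments.
Unset Strict Implicit.
Unset Printing Implicit Defensive.
Import Order.TTheory GRing.Theory Num.Theory.
Local Open Scope ring_scope.

(* A directed graph on the vertex set 'I_n is given by its set of edges, the
   pair (u, v) being an edge from u to v; parallel edges are thus excluded. *)
Notation edges n := {set 'I_n * 'I_n}.

Definition loopless n (E : edges n) : bool :=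
  [forall v : 'I_n, (v, v) \notin E].

Notation triple n := ({set 'I_n} * {set 'I_n} * {set 'I_n})%type.

Definition Lpart n (c : triple n) := c.1.1.
Definition Spart n (c : triple n) := c.1.2.
Definition Rpart n (c : triple n) := c.2.

(* finset's [partition] forbids empty blocks, whereas S may be empty here. *)
Definition vertex_cut n (E : edges n) (c : triple n) : bool :=
  [&& Lpart c :|: Spart c :|: Rpart c == [set: 'I_n],
      [disjoint Lpart c & Spart c], [disjoint Lpart c & Rpart c],
      [disjoint Spart c & Rpart c],
      Lpart c != set0, Rpart c != set0
    & [forall u in Lpart c, forall v in Rpart c, (u, v) \notin E]].

Definition rooted_cut n (E : edges n) (y : 'I_n) (c : triple n) : bool :=
  vertex_cut E c && (y \in Rpart c).

Definition cut_weight n (w : 'I_n -> nat) (c : triple n) : nat :=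
  (\sum_(v in Spart c) w v)%N.

(* The default value w(V) of the two minima bounds the weight of every cut from
   above, so it is irrelevant as soon as there is a cut to minimize over. *)
Definition OPT n (w : 'I_n -> nat) (E : edges n) : nat :=
  \big[minn/(\sum_v w v)%N]_(c : triple n
                              | vertex_cut E c) cut_weight w c.

Definition OPT_rooted n (w : 'I_n -> nat) (E : edges n) (y : 'I_n)
    : nat :=
  \big[minn/(\sum_v w v)%N]_(c : triple n
                              | rooted_cut E y c) cut_weight w c.

(* Orc E y c is the probability that the query (E, y) is answered by c; each
   call is answered with fresh randomness (see [exec]). *)
Definition oracle (R : realType) (n : nat) : Type :=
  edges n -> 'I_n -> triple n -> R.

Definition rooted_mincut_oracle (R : realType) n (w : 'I_n -> nat) (eps : R)
    (Orc : oracle R n) : Prop :=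
  forall (E : edges n) (y : 'I_n),
    loopless E -> (exists c, rooted_cut E y c) ->
    [/\ forall c, 0 <= Orc E y c,
        \sum_c Orc E y c = 1,
        forall c, 0 < Orc E y c -> rooted_cut E y c
      & 1 / 2 <= \sum_(c | (cut_weight w c)%:R
                             <= (1 + eps) * (OPT_rooted w E y)%:R) Orc E y c].

Inductive ptree (R : realType) (T : Type) : Type :=
| Ret of T
| Choose (I : finType) of (I -> R) & (I -> ptree R T).
Arguments Ret {R T}.
Arguments Choose {R T I}.

Fixpoint pbind (R : realType) (T U : Type) (d : ptree R T)
    (f : T -> ptree R U) : ptree R U :=
  match d with
  | Ret x => f x
  | Choose _ p k => Choose p (fun i => pbind (k i) f)
  end.

Fixpoint Pr (R : realType) (T : Type) (A : T -> bool) (d : ptree R T) : R :=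
  match d with
  | Ret x => (A x)%:R
  | Choose _ p k => \sum_i p i * Pr A (k i)
  end.

(* A holds at every outcome of positive probability. *)
Fixpoint always (R : realType) (T : Type) (A : T -> Prop) (d : ptree R T)
    : Prop :=
  match d with
  | Ret x => A x
  | Choose _ p k => forall i, 0 < p i -> always A (k i)
  end.

(* A program has finitely many scalar variables and arrays, named by nat; all
   values and array indices are words of b bits. *)

Inductive binop := Add | Sub | Mul | Div | Mod | Lt | Eq.

Inductive expr :=
| Const of nat
| Var of nat
| Read of nat & expr
| Bin of binop & expr & expr
| EpsMul of expr.

Inductive cmd :=
| Skip
| Assign of nat & expr
| Write of nat & expr & expr
| Seq of cmd & cmd
| If of expr & cmd & cmd
| While of expr & cmd
| Rand of nat & expr
| Query (count : expr) (tails heads : nat) (root : expr) (answer : nat).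

Record state := State {
  vars : nat -> nat;
  arrays : nat -> nat -> nat;
  steps : nat;           (* time spent outside of oracle queries *)
  queries : nat;
  query_edges : nat      (* total number of edges of the queried graphs *)
}.

Definition tick (s : state) : state :=
  State (vars s) (arrays s) (steps s).+1 (queries s) (query_edges s).

Definition set_var (x v : nat) (s : state) : state :=
  State (fun x' => if x' == x then v else vars s x') (arrays s)
        (steps s) (queries s) (query_edges s).

Definition set_cell (a i v : nat) (s : state) : state :=
  State (vars s)
        (fun a' i' => if (a' == a) && (i' == i) then v else arrays s a' i')
        (steps s) (queries s) (query_edges s).

Definition eval_binop (op : binop) (x y : nat) : nat :=
  match op with
  | Add => (x + y)%N
  | Sub => (x - y)%N
  | Mul => (x * y)%N
  | Div => (x %/ y)%N
  | Mod => (x %% y)%N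
  | Lt => (x < y)%N
  | Eq => x == y
  end.

(* The results of operations are reduced modulo 2 ^ b.  The real input eps is
   not a word: a program accesses it through the values floor (eps * x), for x
   a word, capped at the largest word. *)
Fixpoint eval (R : realType) (b : nat) (eps : R) (s : state) (e : expr) : nat :=
  match e with
  | Const k => (k %% 2 ^ b)%N
  | Var x => vars s x
  | Read a i => arrays s a (eval b eps s i)
  | Bin op e1 e2 =>
      (eval_binop op (eval b eps s e1) (eval b eps s e2) %% 2 ^ b)%N
  | EpsMul e1 =>
      minn (2 ^ b).-1 (Num.truncn (eps * (eval b eps s e1)%:R))
  end.

(* Triples as arrays of labels: 0 for L, 1 for S, 2 for R. *)
Definition label n (c : triple n) (v : 'I_n) : nat :=
  if v \in Lpart c then 0%N else if v \in Spart c then 1%N else 2%N.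

Definition read_triple n (a : nat) (s : state)
    : triple n :=
  ([set v : 'I_n | arrays s a v == 0%N],
   [set v : 'I_n | arrays s a v == 1%N],
   [set v : 'I_n | arrays s a v == 2%N]).

Definition write_triple n (a : nat) (c : triple n)
    (s : state) : state :=
  State (vars s)
        (fun a' i => if a' == a then
                       if insub i is Some v then label c v else arrays s a' i
                     else arrays s a' i)
        (steps s) (queries s) (query_edges s).

Definition count_query (k : nat) (s : state) : state :=
  State (vars s) (arrays s) (steps s) (queries s).+1 (query_edges s + k)%N.

Definition listed_edges (s : state) (tails heads k : nat) : seq (nat * nat) :=
  [seq (arrays s tails i, arrays s heads i) | i <- iota 0 k].

Definition listed_graph n (l : seq (nat * nat)) : edges n :=
  [set e : 'I_n * 'I_n | (val e.1, val e.2) \in l].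

(* The list l describes a directed graph on 'I_n with exactly size l edges. *)
Definition legal_list (n : nat) (l : seq (nat * nat)) : bool :=
  uniq l && all (fun e => [&& (e.1 < n)%N, (e.2 < n)%N & e.1 != e.2]) l.

(* None is the outcome of a run that fails: it exhausts the fuel, draws from an
   empty range, or submits an illegal query.  Every elementary command and every
   evaluation of a guard takes one time unit: the sizes of the expressions are
   constants of the program. *)
Fixpoint exec (R : realType) (n b : nat) (eps : R) (Orc : oracle R n)
    (fuel : nat) (p : cmd) (s : state) : ptree R (option state) :=
  if fuel is f.+1 then
    match p with
    | Skip => Ret (Some (tick s))
    | Assign x e => Ret (Some (tick (set_var x (eval b eps s e) s)))
    | Write a i e =>
        Ret (Some (tick (set_cell a (eval b eps s i) (eval b eps s e) s)))
    | Seq p1 p2 =>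
        pbind (exec b eps Orc f p1 s)
              (fun o => if o is Some s' then exec b eps Orc f p2 s' else Ret None)
    | If e p1 p2 =>
        exec b eps Orc f (if eval b eps s e != 0%N then p1 else p2) (tick s)
    | While e p1 =>
        if eval b eps s e != 0%N
        then exec b eps Orc f (Seq p1 (While e p1)) (tick s)
        else Ret (Some (tick s))
    | Rand x e =>
        let k := eval b eps s e in
        if k == 0%N then Ret None
        else Choose (fun _ : 'I_k => k%:R^-1)
                    (fun i : 'I_k => Ret (Some (tick (set_var x i s))))
    | Query count tails heads root answer =>
        let k := eval b eps s count in
        let l := listed_edges s tails heads k in
        let E := listed_graph n l in
        if insub (eval b eps s root) is Some y then
          if legal_list n l && [exists c, rooted_cut E y c] then
            Choose (Orc E y)
                   (fun c => Ret (Some (tick (count_query k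
                                               (write_triple answer c s)))))
          else Ret None
        else Ret None
    end
  else Ret None.

(* On input, variables 0, 1, 2 hold n, the number of edges and W; array 0 holds
   the vertex weights, arrays 1 and 2 the tails and heads of the edges, in the
   order of the list es; everything else is 0.  On output, array 3 holds the
   labels of a triple. *)
Definition init_state n (w : 'I_n -> nat) (W : nat) (es : seq ('I_n * 'I_n))
    : state :=
  State (nth 0%N [:: n; size es; W])
        (fun a => nth 0%N (nth [::] [:: [seq w v | v <- enum 'I_n];
                                        [seq val e.1 | e <- es];
                                        [seq val e.2 | e <- es]] a))
        0 0 0.

Definition output n (s : state) : triple n :=
  read_triple n 3 s.

Definition word_bits (c n W : nat) : nat :=
  (c * (trunc_log 2 n + trunc_log 2 W + 1))%N.

(* m * log W * log^k m up to the constant C, where the shifts prevent the bound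
   from vanishing for m <= 1 or W = 1. *)
Definition soft_O_bound (C k m W : nat) : nat :=
  (C * m.+1 * (trunc_log 2 W).+1 * trunc_log 2 m.+2 ^ k)%N.

(* Main.v *)
(* A root y in R makes every edge leaving an in-neighbour of y irrelevant, since
   such a vertex cannot be in L.  So the rooted query at y only needs the edges
   into y and the edges leaving the vertices that are not in-neighbours of y.

   Let Z be the largest value of w(V) - w(N(v)) over the in- or
   out-neighbourhoods N(v) that leave out some vertex other than v.  In a minimum
   vertex-cut (L, S, R), the set L u R has weight at least Z, and all its
   vertices have weight at most Z.  Let V' be the set of vertices of weight at
   most Z.  For every u, the vertices of V' that are not out-neighbours of u weigh
   at most Z.  Hence every out-degree is at least q - 1, where q = w(V') / Z, so
   that q = O(m / n) when m >= n; and for a root y drawn from V' with probability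
   proportional to w(y), an edge is kept with probability at most 1 / q, so that
   the query has n + m / q edges on average.

   A root drawn in this way, for the graph or for its reverse, falls in R,
   respectively in L, with probability at least 1 / (2 q), and O(q) rounds
   succeed with constant probability, within a budget of O(m) edges by Markov's
   inequality.  When m < n, some vertex has no incoming edge, and there is a
   vertex-cut with S empty. *)
Require Import Defs.
From mathcomp Require Import all_boot all_order all_algebra.
From mathcomp Require Import boolp reals zify ring lra.
Import Order.TTheory GRing.Theory Num.Theory.
Set Implicit Arguments.
Unset Strict Implicit.
Unset Printing Implicit Defensive.

(** * Program logic *)

(** The rounds are not independent: whether a query is asked depends on the edges counted so far.
    Since [exec] yields a tree and not a probability space with independent draws, the analysis goes
    backwards from the last round. With j roots still to be drawn and U edges counted, success is
    claimed with probability at least 1 - (1 - [hit])^j - (U + j * [mu]) / (300 m): a union bound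
    over the event that no round succeeds and, by Markov's inequality, the event that the final
    count exceeds the budget. Each draw, query and skipped round is shown to respect this bound on
    average, so that it holds at the root of the tree.

    A skipped query still adds its size to the count. The increments at drawn roots thus have mean
    at most [mu] whatever happened before, and once the count exceeds 300 m the claimed bound is at
    most 0, so that nothing remains to be shown. *)

Local Notation env := (nat -> nat).
Local Notation store := (nat -> nat -> nat).

Definition upd (v : env) (x k : nat) : env :=
  fun x' => if x' == x then k else v x'.
Definition upd2 (a : store) (r i k : nat) : store :=
  fun r' i' => if (r' == r) && (i' == i) then k else a r' i'.

Arguments upd v x k x' /.
Arguments upd2 a r i k r' i' /.

Fixpoint wvars (p : cmd) : seq nat :=
  match p with
  | Assign x _ | Rand x _ => [:: x]
  | Seq p1 p2 | If _ p1 p2 => wvars p1 ++ wvars p2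
  | While _ p1 => wvars p1
  | _ => [::]
  end.
Fixpoint warrs (p : cmd) : seq nat :=
  match p with
  | Write r _ _ => [:: r]
  | Query _ _ _ _ r => [:: r]
  | Seq p1 p2 | If _ p1 p2 => warrs p1 ++ warrs p2
  | While _ p1 => warrs p1
  | _ => [::]
  end.

Definition agree (xs rs : seq nat) (v : env) (a : store) (v' : env) (a' : store) :=
  (forall x, x \notin xs -> v' x = v x) /\
  (forall r, r \notin rs -> forall i, a' r i = a r i).

Lemma agree_refl xs rs v a : agree xs rs v a v a.
Proof. by []. Qed.

Lemma agree_trans xs rs v1 a1 v2 a2 v3 a3 :
  agree xs rs v1 a1 v2 a2 -> agree xs rs v2 a2 v3 a3 -> agree xs rs v1 a1 v3 a3.
Proof.
move=> [h1 k1] [h2 k2]; split=> [x hx | r hr i]; first by rewrite h2 ?h1.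
by rewrite k2 ?k1.
Qed.

Lemma agreeW xs rs xs' rs' v a v' a' :
  {subset xs <= xs'} -> {subset rs <= rs'} ->
  agree xs rs v a v' a' -> agree xs' rs' v a v' a'.
Proof.
move=> hx hr [h k]; split=> [x hx' | r hr' i].
  by rewrite h //; apply: contra hx'; exact: hx.
by rewrite k //; apply: contra hr'; exact: hr.
Qed.

Definition For (i : nat) (hi : expr) (p : cmd) : cmd :=
  Seq (Assign i (Const 0))
      (While (Bin Lt (Var i) hi) (Seq p (Assign i (Bin Add (Var i) (Const 1))))).

Section Logic.
Variables (R : realType) (n b : nat) (eps : R) (Orc : oracle R n).

Notation run f p s := (exec b eps Orc f p s).

Definition ev (v : env) (a : store) (e : expr) : nat :=
  eval b eps (State v a 0 0 0) e.

Lemma evalE s e : eval b eps s e = ev (vars s) (arrays s) e.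
Proof.
by elim: e => //= [r e -> | o e1 -> e2 -> | e ->].
Qed.

(* Evaluation without the reduction modulo 2 ^ b, valid when nothing
   overflows. *)
Fixpoint uev (v : env) (a : store) (e : expr) : nat :=
  match e with
  | Const k => k
  | Var x => v x
  | Read r i => a r (uev v a i)
  | Bin op e1 e2 => eval_binop op (uev v a e1) (uev v a e2)
  | EpsMul _ => 0
  end.

Fixpoint safe (v : env) (a : store) (e : expr) : Prop :=
  match e with
  | Const k => k < 2 ^ b
  | Var x => True
  | Read r i => safe v a i
  | Bin op e1 e2 => [/\ safe v a e1, safe v a e2 &
                       eval_binop op (uev v a e1) (uev v a e2) < 2 ^ b]
  | EpsMul _ => False
  end.

Lemma evE v a e : safe v a e -> ev v a e = uev v a e.
Proof.
elim: e => //= [k | r e IH | op e1 IH1 e2 IH2].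
- exact: modn_small.
- by move=> /IH h; rewrite /ev /= -/(ev v a e) h.
- move=> [/IH1 h1 /IH2 h2 h].
  by rewrite /ev /= -/(ev v a e1) -/(ev v a e2) h1 h2 modn_small.
Qed.

(** A tree that is a single [Ret] contains no draw and no query, so only assignments and writes have
    to be traced. *)
Lemma run_frame f p s s' : run f p s = Ret (Some s') ->
  agree (wvars p) (warrs p) (vars s) (arrays s) (vars s') (arrays s').
Proof.
elim: f p s s' => [|f IH] //= [] /=.
- by move=> s s' [<-].
- move=> x e s s' [<-]; split=> //= x'; rewrite inE => /negPf -> //.
- move=> r i e s s' [<-]; split=> //= r'; rewrite inE => /negPf -> //.
- move=> p1 p2 s s'.
  case E1: (run f p1 s) => [[s1|]|] //= h2.
  apply: (@agree_trans _ _ _ _ (vars s1) (arrays s1)).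
    by apply: agreeW (IH _ _ _ E1) => x hx; rewrite mem_cat hx.
  by apply: agreeW (IH _ _ _ h2) => x hx; rewrite mem_cat hx orbT.
- move=> e p1 p2 s s'; case: ifP => _ h;
  by apply: agreeW (IH _ _ _ h) => x hx; rewrite mem_cat hx ?orbT.
- move=> e p s s'; case: ifP => _; last by move=> [<-].
  by move/IH; apply: agreeW => x /=; rewrite mem_cat orbb.
- by move=> x e s s'; case: ifP.
- move=> c t h r ans s s'; case: insub => // y; case: ifP => //.
Qed.

(* The program p, run deterministically from any state with variables v and
   arrays a, takes at most t steps, asks no query and ends in a state
   satisfying P. *)
Definition tri (p : cmd) (v : env) (a : store) (t : nat)
    (P : env -> store -> Prop) : Prop :=
  exists v' a' t' f0, [/\ t' <= t, P v' a' &
    forall f st q qe, f0 <= f ->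
      run f p (State v a st q qe) = Ret (Some (State v' a' (st + t') q qe))].

Lemma tri_frame p v a t P : tri p v a t P ->
  tri p v a t (fun v' a' => P v' a' /\ agree (wvars p) (warrs p) v a v' a').
Proof.
move=> [v' [a' [t' [f0 [ht hP h]]]]]; exists v', a', t', f0; split=> //.
by split=> //; apply: run_frame (h f0 0 0 0 (leqnn _)).
Qed.

Lemma tri_post p v a t t' (P P' : env -> store -> Prop) : tri p v a t P -> t <= t' ->
  (forall v' a', agree (wvars p) (warrs p) v a v' a' -> P v' a' -> P' v' a') ->
  tri p v a t' P'.
Proof.
move=> /tri_frame [v' [a' [t1 [f0 [ht [hP fr] h]]]]] htt hPP.
by exists v', a', t1, f0; split; [exact: leq_trans htt | exact: hPP | ].
Qed.

Lemma tri_skip v a t (P : env -> store -> Prop) : P v a -> tri Skip v a t.+1 P.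
Proof.
by move=> hP; exists v, a, 1, 1; split=> // -[//|f] st q qe _ /=; rewrite addn1.
Qed.

Lemma tri_assign x e v a t (P : env -> store -> Prop) :
  P (upd v x (ev v a e)) a -> tri (Assign x e) v a t.+1 P.
Proof.
move=> hP; exists (upd v x (ev v a e)), a, 1, 1; split=> // -[//|f] st q qe _ /=.
by rewrite addn1 evalE.
Qed.

Lemma tri_write r i e v a t (P : env -> store -> Prop) :
  P v (upd2 a r (ev v a i) (ev v a e)) -> tri (Write r i e) v a t.+1 P.
Proof.
move=> hP; exists v, (upd2 a r (ev v a i) (ev v a e)), 1, 1.
by split=> // -[//|f] st q qe _ /=; rewrite addn1 !evalE.
Qed.

Lemma tri_seq t1 t2 p1 p2 v a t P :
  tri p1 v a t1 (fun v' a' => tri p2 v' a' t2 P) -> t1 + t2 <= t ->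
  tri (Seq p1 p2) v a t P.
Proof.
move=> [v1 [a1 [t1' [f1 [ht1 [v2 [a2 [t2' [f2 [ht2 hP h2]]]]] h1]]]]] ht.
exists v2, a2, (t1' + t2'), (maxn f1 f2).+1; split=> //; first by lia.
move=> [//|f] st q qe; rewrite ltnS geq_max => /andP [hf1 hf2] /=.
by rewrite h1 //= h2 // addnA.
Qed.

Lemma tri_seq_assign x e p v a t P :
  tri p (upd v x (ev v a e)) a t P -> tri (Seq (Assign x e) p) v a t.+1 P.
Proof. by move=> h; apply: (@tri_seq 1 t) => //; apply: tri_assign. Qed.

Lemma tri_seq_write r i e p v a t P :
  tri p v (upd2 a r (ev v a i) (ev v a e)) t P ->
  tri (Seq (Write r i e) p) v a t.+1 P.
Proof. by move=> h; apply: (@tri_seq 1 t) => //; apply: tri_write. Qed.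

Lemma tri_if e p1 p2 v a t P :
  (ev v a e != 0 -> tri p1 v a t P) -> (ev v a e = 0 -> tri p2 v a t P) ->
  tri (If e p1 p2) v a t.+1 P.
Proof.
move=> h1 h2.
have [v' [a' [t' [f0 [ht hP h]]]]] :
  tri (if ev v a e != 0 then p1 else p2) v a t P.
  by case: ifP => [/h1 | /negbFE /eqP /h2].
exists v', a', t'.+1, f0.+1; split=> // -[//|f] st q qe hf /=.
by rewrite evalE /= h // addSnnS.
Qed.

(** Body and exit are treated under the frame condition, so that [I] need not mention what the loop
    never writes. The induction is on the number of remaining iterations; the strict bound on the
    sum pays for the last test of the guard. *)
Lemma tri_while (N : nat) (I : nat -> env -> store -> Prop) (t : nat -> nat) T
    e p v a (P : env -> store -> Prop) :
  I 0 v a ->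
  (forall k v' a', k < N -> agree (wvars p) (warrs p) v a v' a' -> I k v' a' ->
     ev v' a' e != 0 /\ tri p v' a' (t k) (I k.+1)) ->
  (forall v' a', agree (wvars p) (warrs p) v a v' a' -> I N v' a' ->
     ev v' a' e = 0 /\ P v' a') ->
  \sum_(k < N) (t k).+1 < T ->
  tri (While e p) v a T P.
Proof.
move=> h0 hS hN hT.
suff gen : forall j v' a', j <= N -> agree (wvars p) (warrs p) v a v' a' ->
    I (N - j) v' a' -> tri (While e p) v' a' (\sum_(N - j <= k < N) (t k).+1).+1 P.
  have := gen N v a (leqnn _) (agree_refl _ _ _ _); rewrite subnn => /(_ h0).
  by rewrite big_mkord => /tri_post; apply.
elim=> [|j IH] v' a' hj hf hI.
  rewrite subn0 in hI *; have [he hP] := hN _ _ hf hI.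
  rewrite big_geq //; exists v', a', 1, 1; split=> // -[//|f] st q qe _ /=.
  by rewrite evalE /= he /= addn1.
have lt : N - j.+1 < N by lia.
have [he /tri_frame hp] := hS _ _ _ lt hf hI.
have eS : (N - j.+1).+1 = N - j by lia.
have : tri (Seq p (While e p)) v' a' (\sum_(N - j.+1 <= k < N) (t k).+1) P.
  rewrite big_ltn // eS addSn -addnS.
  apply: tri_seq (leqnn _).
  apply: tri_post (leqnn _) _; first exact: hp.
  move=> v1 a1 _ [hI1 hf1]; apply: IH; first by lia.
    exact: agree_trans hf hf1.
  by rewrite -eS.
move=> [v2 [a2 [t2 [f0 [ht2 hP h]]]]].
exists v2, a2, t2.+1, f0.+1; split=> // -[//|f] st q qe hf0 /=.
by rewrite evalE /= he /= h // addSnnS.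
Qed.

(** The bound [hi] is evaluated anew at every test, hence the requirement that it keep the value
    [N]. The two extra units per iteration are the test and the increment, the final 2 the initial
    assignment and the last test. *)
Lemma tri_for (N : nat) (I : nat -> env -> store -> Prop) (t : nat -> nat) T
    i hi p v a (P : env -> store -> Prop) :
  N < 2 ^ b -> 1 < 2 ^ b -> i \notin wvars p ->
  I 0 (upd v i 0) a ->
  (forall k v' a', k <= N -> agree (i :: wvars p) (warrs p) v a v' a' ->
     I k v' a' -> ev v' a' hi = N) ->
  (forall k v' a', k < N -> agree (i :: wvars p) (warrs p) v a v' a' ->
     v' i = k -> I k v' a' ->
     tri p v' a' (t k) (fun v1 a1 => I k.+1 (upd v1 i k.+1) a1)) ->
  (forall v' a', agree (i :: wvars p) (warrs p) v a v' a' -> I N v' a' ->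
     P v' a') ->
  \sum_(k < N) (t k).+2 + 2 <= T ->
  tri (For i hi p) v a T P.
Proof.
move=> hNb h1b hi0 h0 hhi hS hN hT.
rewrite /For; case: T hT => [|T]; first by rewrite addn2.
rewrite addn2 ltnS => hT; apply: tri_seq_assign.
rewrite {1}/ev /= mod0n.
set q := Seq p _.
have sub v' a' : agree (wvars q) (warrs q) (upd v i 0) a v' a' ->
    agree (i :: wvars p) (warrs p) v a v' a'.
  move=> /= [h k]; split=> [x | r hr].
    rewrite inE negb_or => /andP [hx hx'].
    by rewrite h ?mem_cat ?negb_or ?hx' ?inE ?hx // /upd (negPf hx).
  by apply: k; rewrite cats0.
pose J k v' a' := v' i = k /\ I k v' a'.
apply: (@tri_while N J (fun k => (t k).+1)) => //.
- by split=> //; rewrite /upd eqxx.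
- move=> k v' a' hk /sub hf [hvi hI]; split.
    rewrite /ev /= -/(ev v' a' hi) (hhi k) ?(ltnW hk) // hvi hk /=.
    by rewrite modn_small.
  apply: (@tri_seq (t k) 1); last by rewrite addn1.
  apply: tri_post (leqnn _) _; first exact: tri_frame (hS k v' a' hk hf hvi hI).
  move=> v1 a1 _ [hI1 [hf1 _]]; apply: tri_assign.
  have e1 : ev v1 a1 (Bin Add (Var i) (Const 1)) = k.+1.
    rewrite /ev /= hf1 // hvi (modn_small h1b) addn1 modn_small //.
    exact: leq_ltn_trans hNb.
  by rewrite e1; split=> //; rewrite /upd eqxx.
- move=> v' a' /sub hf [hvi hI]; split; last exact: hN.
  by rewrite /ev /= -/(ev v' a' hi) (hhi N) // hvi ltnn mod0n.
Qed.

(** [Seq] consumes fuel according to the bracketing of the program. Giving each pending command its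
    own fuel, with only a lower bound in [holds], lets the rules below treat continuations without
    proving [exec] monotone in its fuel. *)
Fixpoint chain (l : seq (nat * cmd)) (s : state) : ptree R (option state) :=
  if l is (f, p) :: l' then
    pbind (run f p s) (fun o => if o is Some s' then chain l' s' else Ret None)
  else Ret (Some s).

Variables (Q : state -> Prop) (G : state -> bool).

Notation Qo := (fun o : option state => if o is Some s then Q s else False).
Notation Go := (fun o : option state => if o is Some s then G s else false).

(* Running the commands ps in order from s never fails, satisfies Q for sure
   and G with probability at least r. *)
Definition holds (ps : seq cmd) (s : state) (r : R) : Prop :=
  exists f0, forall l, [seq fp.2 | fp <- l] = ps ->
    all (fun fp => f0 <= fp.1) l ->
    always Qo (chain l s) /\ (r <= Pr Go (chain l s))%R.

Lemma pbindA (T U V : Type) (d : ptree R T) (f : T -> ptree R U)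
    (g : U -> ptree R V) :
  pbind (pbind d f) g = pbind d (fun x => pbind (f x) g).
Proof.
by elim: d => //= I p k IH; congr Choose; apply: funext => i.
Qed.

Lemma pbind_ret (T : Type) (d : ptree R T) : pbind d Ret = d.
Proof. by elim: d => //= I p k IH; congr Choose; apply: funext => i. Qed.

Lemma holds_nil s r : Q s -> (r <= (G s)%:R)%R -> holds [::] s r.
Proof. by move=> hQ hr; exists 0 => -[]. Qed.

Lemma holds_le ps s r r' : (r' <= r)%R -> holds ps s r -> holds ps s r'.
Proof.
move=> hr [f0 h]; exists f0 => l h1 h2; have [hQ hG] := h l h1 h2.
by split=> //; exact: le_trans hG.
Qed.

Lemma holds_seq p1 p2 ps s r :
  holds [:: p1, p2 & ps] s r -> holds (Seq p1 p2 :: ps) s r.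
Proof.
move=> [f0 h]; exists f0.+1 => -[//|[[//|f] p] l] /= [-> hl] /andP [hf ha].
have /= := h [:: (f, p1), (f, p2) & l]; rewrite hl -ltnS hf /= => /(_ erefl) /= h'.
rewrite pbindA; set k1 := (X in pbind _ X).
have -> : k1 = fun o => if o is Some s' then
    pbind (run f p2 s') (fun o' => if o' is Some s'' then chain l s'' else Ret None)
    else Ret None.
  by apply: funext => -[].
by apply: h'; apply: sub_all ha => fp; exact: ltnW.
Qed.

Lemma holds_det p v a st q qe ps t P r :
  tri p v a t P ->
  (forall v' a' t', t' <= t -> P v' a' ->
     holds ps (State v' a' (st + t') q qe) r) ->
  holds (p :: ps) (State v a st q qe) r.
Proof.
move=> [v' [a' [t' [f1 [ht hP hrun]]]]] /(_ v' a' t' ht hP) [f0 h].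
exists (maxn f0 f1) => -[//|[f p'] l] /= [-> hl] /andP [].
rewrite geq_max => /andP [hf0 hf1] ha; rewrite hrun //=; apply: h => //.
by apply: sub_all ha => fp; rewrite geq_max => /andP [].
Qed.

Lemma holds_if e p1 p2 ps v a st q qe r :
  (ev v a e != 0 -> holds (p1 :: ps) (State v a st.+1 q qe) r) ->
  (ev v a e = 0 -> holds (p2 :: ps) (State v a st.+1 q qe) r) ->
  holds (If e p1 p2 :: ps) (State v a st q qe) r.
Proof.
move=> h1 h2.
have [f0 h] : holds ((if ev v a e != 0 then p1 else p2) :: ps)
                    (State v a st.+1 q qe) r.
  by case: ifP => [/h1 | /negbFE /eqP /h2].
exists f0.+1 => -[//|[[//|f] p] l] /= [-> hl] /andP [hf ha].
rewrite evalE /=; apply: (h ((f, _) :: l)) => /=; first by rewrite hl.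
by rewrite -ltnS hf; apply: sub_all ha => fp; exact: ltnW.
Qed.

Lemma holds_while_true e p ps v a st q qe r :
  ev v a e != 0 ->
  holds [:: p, While e p & ps] (State v a st.+1 q qe) r ->
  holds (While e p :: ps) (State v a st q qe) r.
Proof.
move=> he /holds_seq [f0 h].
exists f0.+1 => -[//|[[//|f] p'] l] /= [-> hl] /andP [hf ha].
rewrite evalE /= he; apply: (h ((f, _) :: l)) => /=; first by rewrite hl.
by rewrite -ltnS hf; apply: sub_all ha => fp; exact: ltnW.
Qed.

Lemma holds_while_false e p ps v a st q qe r :
  ev v a e = 0 -> holds ps (State v a st.+1 q qe) r ->
  holds (While e p :: ps) (State v a st q qe) r.
Proof.
move=> he [f0 h].
exists f0.+1 => -[//|[[//|f] p'] l] /= [-> hl] /andP [hf ha].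
by rewrite evalE /= he /=; apply: h => //; apply: sub_all ha => fp; exact: ltnW.
Qed.

(* The branching is finite, so the fuel needed by the branches is bounded. *)
Lemma holds_choose (I : finType) (pr : I -> R) (k : I -> state) ps (r : R)
    (rf : I -> R) :
  (forall i, 0 <= pr i)%R ->
  (forall i, (0 < pr i)%R -> holds ps (k i) (rf i)) ->
  (r <= \sum_i pr i * rf i)%R ->
  exists f0, forall l, [seq fp.2 | fp <- l] = ps ->
    all (fun fp => f0 <= fp.1) l ->
    (forall i, (0 < pr i)%R -> always Qo (chain l (k i))) /\
    (r <= \sum_i pr i * Pr Go (chain l (k i)))%R.
Proof.
move=> hpr h hr.
have /choice [F hF] : forall i, exists f0, (0 < pr i)%R ->
    forall l, [seq fp.2 | fp <- l] = ps -> all (fun fp => f0 <= fp.1) l ->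
    always Qo (chain l (k i)) /\ (rf i <= Pr Go (chain l (k i)))%R.
  move=> i; case: (pselect (0 < pr i)%R) => [hi|]; last by exists 0.
  by have [f0 hf0] := h i hi; exists f0.
exists (\max_i F i) => l hl ha.
have hFl i : all (fun fp => F i <= fp.1) l.
  by apply: sub_all ha => fp; apply: leq_trans; exact: (leq_bigmax i).
split=> [i hi|]; first by have [] := hF i hi l hl (hFl i).
apply: le_trans hr _; apply: ler_sum => i _.
have := hpr i; rewrite le_eqVlt => /orP [/eqP <- | hi]; first by rewrite !mul0r.
by rewrite ler_pM2l //; have [] := hF i hi l hl (hFl i).
Qed.

Lemma holds_rand x e ps v a st q qe (k : nat) (rf : 'I_k -> R) (r : R) :
  ev v a e = k -> 0 < k ->
  (forall i : 'I_k, holds ps (State (upd v x i) a st.+1 q qe) (rf i)) ->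
  (r <= \sum_i k%:R^-1 * rf i)%R ->
  holds (Rand x e :: ps) (State v a st q qe) r.
Proof.
move=> he hk h hr.
have hpr (i : 'I_k) : (0 <= k%:R^-1 :> R)%R by rewrite invr_ge0 ler0n.
have [f0 {}h] := holds_choose hpr (fun i _ => h i) hr.
exists f0.+1 => -[//|[[//|f] p'] l] /= [-> hl] /andP [hf ha].
rewrite evalE /= he (gtn_eqF hk) /=.
by apply: h => //; apply: sub_all ha => fp; exact: ltnW.
Qed.

Lemma holds_query cnt ts hs root ans ps v a st q qe (k : nat) (y : 'I_n)
    (l : seq (nat * nat)) (rf : triple n -> R) (r : R) :
  ev v a cnt = k -> ev v a root = y ->
  listed_edges (State v a st q qe) ts hs k = l -> legal_list n l ->
  (exists c, rooted_cut (listed_graph n l) y c) ->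
  (forall c, 0 <= Orc (listed_graph n l) y c)%R ->
  (forall c, (0 < Orc (listed_graph n l) y c)%R ->
     holds ps (tick (count_query k (write_triple ans c (State v a st q qe))))
           (rf c)) ->
  (r <= \sum_c Orc (listed_graph n l) y c * rf c)%R ->
  holds (Query cnt ts hs root ans :: ps) (State v a st q qe) r.
Proof.
move=> hk hy hl hleg hcut h0 h hr.
have [f0 {}h] := holds_choose h0 h hr.
exists f0.+1 => -[//|[[//|f] p'] l'] /= [-> hl'] /andP [hf ha].
rewrite !evalE /= hk hy hl valK hleg /=.
have -> : [exists c, rooted_cut (listed_graph n l) y c].
  by apply/existsP.
by apply: h => //; apply: sub_all ha => fp; exact: ltnW.
Qed.

Lemma holds_exec p s r : holds [:: p] s r ->
  exists f, always Qo (run f p s) /\ (r <= Pr Go (run f p s))%R.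
Proof.
move=> [f h]; exists f; have := h [:: (f, p)] erefl.
rewrite /= leqnn => /(_ isT).
have -> : (fun o => if o is Some s' then Ret (Some s') else Ret None) =
          @Ret R (option state) by apply: funext => -[].
by rewrite pbind_ret.
Qed.

End Logic.

Lemma always_impl (R : realType) (T : Type) (P P' : T -> Prop) (d : ptree R T) :
  (forall x, P x -> P' x) -> always P d -> always P' d.
Proof. by move=> h; elim: d => [x|I p k IH] /=; [exact: h | move=> hk i /hk /IH]. Qed.

Lemma holds_impl (R : realType) n b (eps : R) (Orc : oracle R n) (Q Q' : state -> Prop)
    G ps s r : (forall s, Q s -> Q' s) ->
  holds b eps Orc Q G ps s r -> holds b eps Orc Q' G ps s r.
Proof.
move=> h [f0 hf]; exists f0 => l h1 h2; have [hA hP] := hf l h1 h2.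
by split=> //; apply: always_impl hA => -[s'|] //; exact: h.
Qed.

(** * Vertex-cuts and the sampling mass *)

Lemma bigmin_le (I : eqType) (r : seq I) (P : pred I) (F : I -> nat) x j :
  j \in r -> P j -> \big[minn/x]_(i <- r | P i) F i <= F j.
Proof.
elim: r => [//|i r IH]; rewrite inE big_cons => /orP [/eqP <- -> | jr Pj].
  exact: geq_minl.
by case: ifP => _; rewrite ?geq_min IH ?orbT.
Qed.

(** Either a term attains the minimum or the minimum is the default [x]; in the latter case [j]
    attains it, its term lying between the minimum and [x]. *)
Lemma bigmin_attained (I : eqType) (r : seq I) (P : pred I) (F : I -> nat) x j :
  j \in r -> P j -> (forall i, P i -> F i <= x) ->
  exists2 i, P i & F i = \big[minn/x]_(i <- r | P i) F i.
Proof.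
move=> jr Pj hx.
have : {i | P i & F i = \big[minn/x]_(i <- r | P i) F i} +
       {x = \big[minn/x]_(i <- r | P i) F i}.
  elim: r {jr} => [|i r IH]; first by right; rewrite big_nil.
  rewrite big_cons; case: ifP => // Pi.
  have [le | lt] := leqP (F i) (\big[minn/x]_(i <- r | P i) F i).
    by left; exists i.
  case: IH lt => [[i' Pi' <-] lt | <-]; last by rewrite ltnNge hx.
  by left; exists i'.
case=> [[i] | e]; first by exists i.
by exists j => //; apply/eqP; rewrite eqn_leq (bigmin_le F x jr Pj) -e hx.
Qed.

Section Cuts.
Variables (n : nat) (E : edges n) (w : 'I_n -> nat).

Definition wsum : nat := \sum_v w v.

Lemma cut_weight_le_wsum c : cut_weight w c <= wsum.
Proof. by rewrite /cut_weight /wsum big_mkcond leq_sum // => v _; case: ifP. Qed.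

Lemma OPT_le c : vertex_cut E c -> OPT w E <= cut_weight w c.
Proof. by move=> hc; apply: bigmin_le => //; rewrite mem_index_enum. Qed.

Lemma OPT_rooted_le y c : rooted_cut E y c -> OPT_rooted w E y <= cut_weight w c.
Proof. by move=> hc; apply: bigmin_le => //; rewrite mem_index_enum. Qed.

Lemma OPT_attained c : vertex_cut E c ->
  exists2 c', vertex_cut E c' & cut_weight w c' = OPT w E.
Proof.
move=> hc; apply: (bigmin_attained (j := c)) => //; first by rewrite mem_index_enum.
by move=> c' _; exact: cut_weight_le_wsum.
Qed.

(** The partition becomes three membership bits with sum 1 at every vertex, which turns later set
    arguments into case analyses on Booleans. *)
Lemma vertex_cutP c : reflect
  [/\ forall v, (v \in Lpart c) + (v \in Spart c) + (v \in Rpart c) = 1,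
      Lpart c != set0, Rpart c != set0
    & forall u v, u \in Lpart c -> v \in Rpart c -> (u, v) \notin E]
  (vertex_cut E c).
Proof.
case: c => [[L S] T]; rewrite /vertex_cut /Lpart /Spart /Rpart /=.
apply: (iffP idP).
  move=> /and5P [/eqP hU /pred0P hLS /pred0P hLR /pred0P hSR /and3P [hL hR hE]].
  split=> // [v | u v hu hv].
    have := in_setT v; rewrite -hU !inE.
    have /= := hLS v; have /= := hLR v; have /= := hSR v.
    by case: (v \in L); case: (v \in S); case: (v \in T).
  by move/forall_inP: hE => /(_ u hu) /forall_inP /(_ v hv).
move=> [h hL hR hE].
apply/and5P; split; last (apply/and3P; split=> //).
- apply/eqP/setP => v; rewrite !inE; have := h v.
  by case: (v \in L); case: (v \in S); case: (v \in T).
- by apply/pred0P => v /=; have := h v; case: (v \in L); case: (v \in S).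
- by apply/pred0P => v /=; have := h v; case: (v \in L); case: (v \in S); case: (v \in T).
- by apply/pred0P => v /=; have := h v; case: (v \in L); case: (v \in S); case: (v \in T).
- by apply/forall_inP => u hu; apply/forall_inP => v hv; exact: hE.
Qed.

End Cuts.

(** * A graph and its reverse, star cuts and rooted query graphs *)

Section Doubling.
Variables (n : nat) (E : edges n) (w : 'I_n -> nat).

(* The direction d selects the graph (false) or its reverse (true). *)
Definition dirE (d : bool) : edges n :=
  if d then [set e | (e.2, e.1) \in E] else E.

Notation node := (bool * 'I_n)%type.

Definition innbr (z : node) : {set 'I_n} := [set u | (u, z.2) \in dirE z.1].

Definition flip (d : bool) (c : triple n) : triple n :=
  if d then (Rpart c, Spart c, Lpart c) else c.

Lemma in_dirE_neg d u v : ((u, v) \in dirE (~~ d)) = ((v, u) \in dirE d).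
Proof. by case: d; rewrite /= inE. Qed.

Lemma nin_sym d u v : (u \in innbr (d, v)) = (v \in innbr (~~ d, u)).
Proof. by rewrite !inE /= in_dirE_neg. Qed.

Lemma vertex_cut_flip d c : vertex_cut (dirE d) c = vertex_cut E (flip d c).
Proof.
case: d => //=; case: c => [[L S] T]; rewrite /flip /Lpart /Spart /Rpart /=.
apply/vertex_cutP/vertex_cutP; rewrite /Lpart /Spart /Rpart /=.
  move=> [h hL hR hE]; split=> // [v | u v hu hv].
    by have := h v; case: (v \in L); case: (v \in S); case: (v \in T).
  by have := hE _ _ hv hu; rewrite inE.
move=> [h hL hR hE]; split=> // [v | u v hu hv].
  by have := h v; case: (v \in L); case: (v \in S); case: (v \in T).
by rewrite inE /=; exact: hE.
Qed.

Lemma cut_weight_flip d c : cut_weight w (flip d c) = cut_weight w c.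
Proof. by case: d. Qed.

Hypothesis loopE : loopless E.

Lemma dirE_loop d v : ((v, v) \in dirE d) = false.
Proof.
by move/forallP: loopE => /(_ v) /negbTE h; case: d => //=; rewrite inE.
Qed.

Lemma nin_self z : (z.2 \in innbr z) = false.
Proof. by rewrite inE dirE_loop. Qed.

Lemma nin_le z : #|innbr z| <= n.-1.
Proof.
have := cardsC1 z.2; rewrite card_ord => <-.
apply/subset_leq_card/subsetP => u hu; rewrite !inE.
by apply: contraTneq hu => ->; rewrite nin_self.
Qed.

Lemma rest_neq0 z : (#|innbr z| < n.-1) = (~: (z.2 |: innbr z) != set0).
Proof.
rewrite -card_gt0 [in RHS]cardsCs setCK cardsU1 nin_self card_ord.
move: (nin_le z) (ltn_ord z.2); move: #|_| => k hk hz; rewrite /=; apply/idP/idP; lia.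
Qed.

(** The cut that separates [z.2] by its in-neighbourhood. [radius] maximizes the weight that such
    cuts leave outside of S. *)
Definition star_cut (z : node) : triple n := (~: (z.2 |: innbr z), innbr z, [set z.2]).

Lemma star_cutP z : #|innbr z| < n.-1 -> rooted_cut (dirE z.1) z.2 (star_cut z).
Proof.
rewrite rest_neq0 => hz; apply/andP; split; last by rewrite inE.
apply/vertex_cutP; rewrite /Lpart /Spart /Rpart /=; split=> //.
- move=> v; rewrite in_setC in_setU1 !in_set1; have := nin_self z.
  case: eqP => [-> -> // | _ _]; by case: (v \in _).
- by apply/set0Pn; exists z.2; rewrite inE.
- by move=> u v hu /set1P ->; move: hu; rewrite !inE negb_or => /andP [].
Qed.

Definition iw (z : node) : nat := \sum_(u in innbr z) w u.

Lemma iwC z : wsum w - iw z = \sum_(u | u \notin innbr z) w u.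
Proof. by rewrite /wsum (bigID (mem (innbr z))) /= -/(iw z) addKn. Qed.

(* Up to a factor 2, the largest weight of [L :|: R] over all vertex-cuts. *)
Definition radius : nat := \max_(z : node | #|innbr z| < n.-1) (wsum w - iw z).

Definition aw (v : 'I_n) : nat := if w v <= radius then w v else 0.

(** Every vertex counts once per direction, so [mass / radius] is twice the ratio q of the
    overview. *)
Definition mass : nat := \sum_(z : node) aw z.2.

Lemma aw_le v : aw v <= w v.
Proof. by rewrite /aw; case: ifP. Qed.

Lemma aw_radius v : aw v <= radius.
Proof. by rewrite /aw; case: ifP. Qed.

Lemma massE : mass = 2 * \sum_v aw v.
Proof.
have -> : mass = \sum_(d : bool) \sum_v aw v by rewrite pair_bigA.
by rewrite big_bool /= mul2n -addnn.
Qed.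

(** The sum runs over the vertices that are not out-neighbours of [u]. If one of them differs from
    [u], the star at [u] in the opposite direction enters the maximum in [radius]. Otherwise only
    [u] itself is left, and the truncation in [aw] gives the bound. *)
Lemma out_aw d u : \sum_(y | u \notin innbr (d, y)) aw y <= radius.
Proof.
have [h | h] := ltnP (#|innbr (~~ d, u)|) n.-1.
  apply: (@leq_trans (wsum w - iw (~~ d, u))); last first.
    by rewrite /radius; exact: (leq_bigmax_cond (F := fun z => wsum w - iw z)).
  rewrite iwC [leqLHS](eq_bigl (fun y => y \notin innbr (~~ d, u))); last first.
    by move=> y; rewrite nin_sym.
  by apply: leq_sum => y _; exact: aw_le.
apply: leq_trans (aw_radius u).
have sub y : u \notin innbr (d, y) -> y = u.
  rewrite nin_sym => hy; apply/eqP.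
  move: h; rewrite leqNgt rest_neq0 negbK => /eqP /setP /(_ y).
  by rewrite !inE /=; case: (y == u) => //=; move: hy; rewrite inE /= => ->.
rewrite (bigD1 u) /=; last by rewrite (nin_self (d, u)).
rewrite big1 ?addn0 // => y /andP [/sub -> ]; by rewrite eqxx.
Qed.

Definition root_graph (z : node) : edges n :=
  [set e in dirE z.1 | (e.2 == z.2) || (e.1 != z.2) && (e.1 \notin innbr z)].

(* An edge from an in-neighbour of y cannot leave L when y is in R. *)
Lemma root_graph_cut z c : rooted_cut (root_graph z) z.2 c -> vertex_cut (dirE z.1) c.
Proof.
move=> /andP [/vertex_cutP [h hL hR hE] hy]; apply/vertex_cutP; split=> // u v hu hv.
have := hE _ _ hu hv; rewrite inE /=; case: (_ \in _) => //=.
rewrite negb_or negb_and !negbK => /andP [_ /orP [/eqP e | hn]].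
  by have := h u; rewrite hu e hy; case: (_ \in _).
have := hE _ _ hu hy; rewrite inE /= eqxx andbT.
by move: hn; rewrite inE => ->.
Qed.

Lemma cut_root_graph z c : vertex_cut (dirE z.1) c -> z.2 \in Rpart c ->
  rooted_cut (root_graph z) z.2 c.
Proof.
move=> /vertex_cutP [h hL hR hE] hy; apply/andP; split=> //.
apply/vertex_cutP; split=> // u v hu hv.
by rewrite inE negb_and hE.
Qed.

(** The nodes whose rooted query can find [c]; in the reverse graph L plays the role of R. *)
Definition good (c : triple n) (z : node) : bool :=
  z.2 \in (if z.1 then Lpart c else Rpart c).

Lemma good_cut c z : vertex_cut E c -> good c z ->
  rooted_cut (root_graph z) z.2 (flip z.1 c).
Proof.
move=> hc; rewrite /good => hg; apply: cut_root_graph.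
  by rewrite vertex_cut_flip; case: (z.1) hc; case: c {hg} => [[]].
by case: (z.1) hg.
Qed.

(** * Bounds on the radius, the mass and the sizes of the queries *)

Section Bounds.
Hypothesis w_gt0 : forall v, 0 < w v.

Lemma radius_cut_weight z : #|innbr z| < n.-1 -> OPT w E <= iw z.
Proof.
move=> /star_cutP /andP [hc _]; rewrite vertex_cut_flip in hc.
by have := OPT_le w hc; rewrite cut_weight_flip.
Qed.

Lemma radius_OPT : radius <= wsum w - OPT w E.
Proof.
apply/bigmax_leqP => z hz; have := radius_cut_weight hz; lia.
Qed.

(** A vertex on the other side of [c] is neither the root nor one of its in-neighbours, so the star
    at [z] is a cut. Its root lies outside of the separator and so weighs at most [radius]: the
    truncation in [aw] discards no good root. *)
Lemma good_radius c z : vertex_cut E c -> good c z -> w z.2 <= radius.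
Proof.
move=> hc hg.
have := good_cut hc hg; move=> /root_graph_cut /vertex_cutP [h hL hR hE].
have hy : z.2 \in Rpart (flip z.1 c) by move: hg; rewrite /good; case: (z.1).
have [x hx] := set0Pn _ hL.
have hz : #|innbr z| < n.-1.
  rewrite rest_neq0; apply/set0Pn; exists x.
  rewrite !inE negb_or (hE _ _ hx hy) andbT; apply/eqP => e.
  by have := h x; rewrite hx e hy; case: (_ \in _).
apply: (@leq_trans (wsum w - iw z)).
  by rewrite iwC (bigD1 z.2) ?nin_self //= leq_addr.
exact: (leq_bigmax_cond (F := fun z => wsum w - iw z)).
Qed.

Lemma radius_gt0 c : vertex_cut E c -> 0 < radius.
Proof.
move=> hc; have /vertex_cutP [h hL hR hE] := hc.
have [y hy] := set0Pn _ hR.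
by apply: leq_trans (good_radius (z := (false, y)) hc hy).
Qed.

(** The good nodes are R in one direction and L in the other, of total weight w(V) - OPT; and no
    star cut weighs less than OPT. *)
Lemma mass_good c : vertex_cut E c -> cut_weight w c = OPT w E ->
  radius <= \sum_(z | good c z) aw z.2.
Proof.
move=> hc ho; apply: leq_trans radius_OPT _.
have -> : \sum_(z | good c z) aw z.2 = \sum_(z | good c z) w z.2.
  by apply: eq_bigr => z /(good_radius hc) hz; rewrite /aw hz.
have -> : \sum_(z | good c z) w z.2 = \sum_d \sum_(v | good c (d, v)) w v.
  by rewrite pair_big_dep; apply: eq_big => -[].
rewrite big_bool /=.
rewrite -ho /cut_weight leq_subLR /wsum /good /=.
rewrite (big_mkcond (fun v => v \in Spart c)) (big_mkcond (fun v => v \in Lpart c)).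
rewrite (big_mkcond (fun v => v \in Rpart c)) -!big_split /=.
apply: leq_sum => v _; have /vertex_cutP [/(_ v) h _ _ _] := hc.
move: h; case: (v \in Lpart c); case: (v \in Spart c); case: (v \in Rpart c) => //= _;
by rewrite ?addn0.
Qed.

Lemma mass_ge c : vertex_cut E c -> radius <= mass.
Proof.
move=> hc; have [c' hc' ho] := OPT_attained w hc.
by apply: leq_trans (mass_good hc' ho) _; rewrite big_mkcond leq_sum // => z _; case: ifP.
Qed.

Lemma card_E d : \sum_u #|innbr (d, u)| = #|E|.
Proof.
have step (e : edges n) : \sum_u #|[set v | (v, u) \in e]| = #|e|.
  rewrite (eq_bigr (fun u => \sum_(v | (v, u) \in e) 1)); last first.
    by move=> u _; rewrite -sum1_card; apply: eq_bigl => v; rewrite inE.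
  rewrite pair_big_dep -sum1_card /=.
  rewrite (reindex (fun p : 'I_n * 'I_n => (p.2, p.1))) /=; last first.
    by exists (fun p => (p.2, p.1)) => -[].
  by apply: eq_bigl => -[].
rewrite [LHS](eq_bigr (fun u => #|[set v | (v, u) \in dirE d]|)) //.
rewrite step; case: d => //=.
rewrite -[RHS](card_imset _ (f := fun p : 'I_n * 'I_n => (p.2, p.1))); last first.
  by move=> [? ?] [? ?] [-> ->].
apply: eq_card => -[u v]; rewrite inE /=; apply/idP/imsetP => [h | [[a c]] h [-> ->] //].
by exists (v, u).
Qed.

(** The degree bound, summed over all vertices. For each [u], the out-neighbours weigh at most
    [radius] each and the remaining vertices at most [radius] together, by [out_aw]. *)
Lemma mass_le : n * mass <= 2 * (#|E| + n) * radius.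
Proof.
rewrite massE mulnCA -mulnA leq_mul2l /=.
rewrite mulnDl -(card_E true) big_distrl /= -{1}(card_ord n) -sum_nat_const.
rewrite -[in n * radius](card_ord n) -sum_nat_const -big_split /=.
apply: leq_sum => u _; rewrite (bigID (fun y => u \in innbr (false, y))) /=.
apply: leq_add (out_aw _ _).
rewrite -sum_nat_const.
rewrite [leqLHS](eq_bigl (mem (innbr (true, u)))); last by move=> y /=; rewrite nin_sym.
by apply: leq_sum => y _; exact: aw_radius.
Qed.

(** The number of edges of [root_graph z] that leave [u]: an in-neighbour of the root keeps only its
    edge into the root. *)
Definition kept (z : node) (u : 'I_n) : nat :=
  if u \in innbr z then 1 else if u == z.2 then 0 else #|innbr (~~ z.1, u)|.

Definition root_size (z : node) : nat := \sum_u kept z u.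

Lemma root_size_le z : root_size z <= n + #|E|.
Proof.
have e : n = \sum_(u < n) 1 by rewrite sum1_card card_ord.
rewrite /root_size -(card_E (~~ z.1)) [leqRHS](congr1 (addn^~ _) e) -big_split /=.
apply: leq_sum => u _; rewrite /kept.
by case: ifP => _; [|case: ifP => _ //]; rewrite ?leq_addr ?leq_addl.
Qed.

(* Exchanging the sums, an edge leaving u is kept only for the roots outside of
   the neighbourhood of u, whose mass is at most [radius]. *)
Lemma root_size_mean :
  \sum_(z : node) aw z.2 * root_size z <= mass * n + 2 * #|E| * radius.
Proof.
have -> : \sum_(z : node) aw z.2 * root_size z =
    \sum_d \sum_v aw v * root_size (d, v).
  by rewrite pair_bigA /=; apply: eq_bigr => -[].
rewrite massE.
suff h d : \sum_v aw v * root_size (d, v) <= (\sum_v aw v) * n + #|E| * radius.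
  by rewrite big_bool -[2 * _ * n]mulnA -[2 * _ * radius]mulnA -mulnDr mul2n -addnn leq_add.
rewrite -(card_E (~~ d)) !big_distrl -big_split /=.
apply: (@leq_trans (\sum_v (aw v * n +
    \sum_(u | u \notin innbr (d, v)) aw v * #|innbr (~~ d, u)|))).
  have e : n = \sum_(u < n) 1 by rewrite sum1_card card_ord.
  apply: leq_sum => v _; rewrite [X in _ <= _ * X + _]e !big_distrr /=.
  rewrite [X in _ <= _ + X]big_mkcond -big_split /=; apply: leq_sum => u _.
  rewrite /kept; case: (u \in _) => /=; first by rewrite addn0.
  by case: ifP => _; rewrite ?muln0 ?leq_addl.
rewrite !big_split /= leq_add2l (exchange_big_dep xpredT) //=.
apply: leq_sum => u _; rewrite -big_distrl /= mulnC leq_mul2l.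
by rewrite (out_aw d u) orbT.
Qed.

End Bounds.
End Doubling.

(** * The program *)

Local Notation "p ;; q" := (Seq p q) (at level 61, right associativity).
Local Notation "x [+] y" := (Bin Add x y) (at level 50, left associativity).
Local Notation "x [-] y" := (Bin Defs.Sub x y) (at level 50, left associativity).
Local Notation "x [*] y" := (Bin Mul x y) (at level 40, left associativity).
Local Notation "x [/] y" := (Bin Div x y) (at level 40, left associativity).
Local Notation "x [%] y" := (Bin Mod x y) (at level 40, left associativity).
Local Notation "x [<] y" := (Bin Lt x y) (at level 58, no associativity).
Local Notation "x [=] y" := (Bin Eq x y) (at level 58, no associativity).

Local Notation xn := 0 (only parsing).
Local Notation xm := 1 (only parsing).
Local Notation xe := 3 (only parsing).
Local Notation xt := 4 (only parsing).
Local Notation xh := 5 (only parsing).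
Local Notation xx := 6 (only parsing).
Local Notation xtot := 7 (only parsing).
Local Notation xv := 8 (only parsing).
Local Notation xrad := 9 (only parsing).
Local Notation xz := 10 (only parsing).
Local Notation xmass := 11 (only parsing).
Local Notation xN := 12 (only parsing).
Local Notation xi := 13 (only parsing).
Local Notation xU := 14 (only parsing).
Local Notation xbw := 15 (only parsing).
Local Notation xd := 16 (only parsing).
Local Notation xy := 17 (only parsing).
Local Notation xo := 18 (only parsing).
Local Notation xc := 19 (only parsing).
Local Notation xu := 20 (only parsing).
Local Notation xj := 21 (only parsing).
Local Notation xk := 22 (only parsing).
Local Notation xcw := 23 (only parsing).
Local Notation xr := 24 (only parsing).
Local Notation rw := 0 (only parsing).
Local Notation rt := 1 (only parsing).
Local Notation rh := 2 (only parsing).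
Local Notation rout := 3 (only parsing).
Local Notation rdeg := 4 (only parsing).
Local Notation rnb := 5 (only parsing).
Local Notation rmat := 6 (only parsing).
Local Notation riw := 7 (only parsing).
Local Notation raw := 8 (only parsing).
Local Notation rqt := 9 (only parsing).
Local Notation rqh := 10 (only parsing).
Local Notation rans := 11 (only parsing).

(* The node z = d * n + y stands for the vertex y of the graph (d = 0) or of its
   reverse (d = 1).  Node z has rdeg[z] in-neighbours rnb[z * m + j], of total
   weight riw[z]; rmat[z * n + u] tells whether u is one of them. *)
Definition add_arc (z u : expr) : cmd :=
  Write rnb (z [*] Var xm [+] Read rdeg z) u ;;
  Write rdeg z (Read rdeg z [+] Const 1) ;;
  Write rmat (z [*] Var xn [+] u) (Const 1) ;;
  Write riw z (Read riw z [+] Read rw u).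

Definition scan : cmd :=
  For xe (Var xm)
    (Assign xt (Read rt (Var xe)) ;;
     Assign xh (Read rh (Var xe)) ;;
     add_arc (Var xh) (Var xt) ;;
     add_arc (Var xn [+] Var xt) (Var xh)).

Definition sparse : cmd :=
  While (Read rdeg (Var xx)) (Assign xx (Var xx [+] Const 1)) ;;
  Write rout (Var xx) (Const 2).

Definition compute_total : cmd :=
  For xv (Var xn) (Assign xtot (Var xtot [+] Read rw (Var xv))).

Definition compute_radius : cmd :=
  For xv (Const 2 [*] Var xn)
    (If (Read rdeg (Var xv) [<] (Var xn [-] Const 1))
        (If (Var xrad [<] (Var xtot [-] Read riw (Var xv)))
            (Assign xrad (Var xtot [-] Read riw (Var xv)) ;;
             Assign xz (Var xv))
            Skip)
        Skip).

(* A weight above the radius counts as 0: the cells of raw are initially 0. *)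
Definition compute_mass : cmd :=
  For xv (Const 2 [*] Var xn)
    (If (Read rw (Var xv [%] Var xn) [<] (Var xrad [+] Const 1))
        (Write raw (Var xv) (Read rw (Var xv [%] Var xn)) ;;
         Assign xmass (Var xmass [+] Read rw (Var xv [%] Var xn)))
        Skip).

(* The out-neighbours of u in the current direction are the in-neighbours of
   the node xo + u, in the opposite direction. *)
Definition count_edges : cmd :=
  Assign xd (Var xz [/] Var xn) ;;
  Assign xy (Var xz [%] Var xn) ;;
  Assign xo ((Const 1 [-] Var xd) [*] Var xn) ;;
  Assign xc (Const 0) ;;
  For xu (Var xn)
    (If (Read rmat (Var xz [*] Var xn [+] Var xu))
        (Assign xc (Var xc [+] Const 1))
        (If (Var xu [=] Var xy) Skip
            (Assign xc (Var xc [+] Read rdeg (Var xo [+] Var xu))))) ;;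
  Assign xU (Var xU [+] Var xc).

Definition push (u v : expr) : cmd :=
  Write rqt (Var xk) u ;;
  Write rqh (Var xk) v ;;
  Assign xk (Var xk [+] Const 1).

Definition emit : cmd :=
  Assign xk (Const 0) ;;
  For xu (Var xn)
    (If (Read rmat (Var xz [*] Var xn [+] Var xu))
        (push (Var xu) (Var xy))
        (If (Var xu [=] Var xy) Skip
            (For xj (Read rdeg (Var xo [+] Var xu))
               (push (Var xu)
                     (Read rnb ((Var xo [+] Var xu) [*] Var xm [+] Var xj)))))).

(* A cut of the reverse graph is recorded with L and R exchanged. *)
Definition keep : cmd :=
  Assign xcw (Const 0) ;;
  For xv (Var xn)
    (If (Read rans (Var xv) [=] Const 1)
        (Assign xcw (Var xcw [+] Read rw (Var xv))) Skip) ;;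
  If (Var xcw [<] Var xbw)
     (Assign xbw (Var xcw) ;;
      For xv (Var xn)
        (Write rout (Var xv)
           (Var xd [*] (Const 2 [-] Read rans (Var xv)) [+]
            (Const 1 [-] Var xd) [*] Read rans (Var xv))))
     Skip.

Definition pick : cmd :=
  Assign xz (Const 0) ;;
  While (Read raw (Var xz) [<] (Var xr [+] Const 1))
    (Assign xr (Var xr [-] Read raw (Var xz)) ;;
     Assign xz (Var xz [+] Const 1)).

Definition redraw : cmd :=
  Rand xr (Var xmass) ;; pick ;; Assign xi (Var xi [+] Const 1).

Definition round : cmd :=
  count_edges ;;
  If ((Var xU [<] (Const 300 [*] Var xm [+] Const 1)) [*]
      (Read rdeg (Var xz) [<] (Var xn [-] Const 1)))
     (emit ;; Query (Var xk) rqt rqh (Var xy) rans ;; keep)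
     Skip ;;
  redraw.

(* The root of the first round realizes the radius: it is always queried, so
   that there is a cut to output. *)
Definition main_loop : cmd := While (Var xi [<] Var xN) round.

Definition dense : cmd :=
  compute_total ;; compute_radius ;; compute_mass ;;
  Assign xN (Const 6 [*] (Var xmass [/] Var xrad) [+] Const 7) ;;
  Assign xbw (Var xtot) ;;
  main_loop.

Definition algo : cmd := scan ;; If (Var xm [<] Var xn) sparse dense.

(** Loop invariants speak of a sum or maximum over the indices below the counter; this is their
    step. *)
Lemma big_lt_next (T : Type) (idx : T) (op : Monoid.com_law idx) (I : finType)
    (code : I -> nat) (F : I -> T) (x : I) : injective code ->
  \big[op/idx]_(y | code y < (code x).+1) F y =
  op (\big[op/idx]_(y | code y < code x) F y) (F x).
Proof.
move=> inj; rewrite (bigD1 x) //= Monoid.mulmC; congr (op _ _).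
apply: eq_bigl => y; rewrite ltnS leq_eqVlt.
case: (eqVneq y x) => [-> | ne] /=; first by rewrite ltnn andbF.
by rewrite andbT (inj_eq inj) (negPf ne).
Qed.

(** For the two-dimensional tables stored in flat arrays: a write to one cell affects no other row
    or column. *)
Lemma mulnD_inj m c1 c2 j1 j2 : j1 < m -> j2 < m ->
  (c1 * m + j1 == c2 * m + j2) = (c1 == c2) && (j1 == j2).
Proof.
move=> h1 h2; apply/eqP/andP => [e | [/eqP -> /eqP -> //]].
have hm : 0 < m by apply: leq_ltn_trans h1.
have e1 : c1 = c2.
  by have := congr1 (divn^~ m) e; rewrite /= !divnMDl // !divn_small // !addn0.
by split; apply/eqP => //; move: e; rewrite e1 => /addnI.
Qed.

(** With [k] the mass and [r] the radius, the lower bound provides enough draws to hit a good root,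
    the upper bound limits the expected number of edges. *)
Lemma six_div (k r : nat) : 0 < r -> r <= k ->
  6 * k <= (6 * (k %/ r) + 6) * r <= 12 * k.
Proof.
move=> r0 rk; have := ltn_ceil k r0; have := leq_trunc_div k r.
rewrite mulnDl -mulnA mulSn; move: (_ %/ _ * _) => t h1 h2; lia.
Qed.

(** * Verification *)

Section Verify.
Variables (R : realType) (n b : nat) (eps : R) (Orc : oracle R n).
Variables (E : edges n) (w : 'I_n -> nat) (es : seq ('I_n * 'I_n)).
Hypothesis loopE : loopless E.
Hypothesis w_gt0 : forall v, 0 < w v.
Hypothesis es_E : perm_eq es (enum E).
Hypothesis n_gt1 : 1 < n.
Hypothesis b_large : 1000 * (wsum w).+1 * n.+1 * (n + #|E|).+1 < 2 ^ b.

Notation TRI := (tri b eps Orc).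
Notation node := (bool * 'I_n)%type.
Notation m := #|E|.
Notation nin := (innbr E).

(** The products that occur in overflow conditions are isolated here, so that linear arithmetic
    settles those conditions. *)
Let X1000 : 1000 < 2 ^ b. Proof. by apply: leq_ltn_trans b_large; nia. Qed.
Let Xn : 1000 * n < 2 ^ b. Proof. by apply: leq_ltn_trans b_large; nia. Qed.
Let Xm : 1000 * m < 2 ^ b. Proof. by apply: leq_ltn_trans b_large; nia. Qed.
Let Xt : 1000 * wsum w < 2 ^ b. Proof. by apply: leq_ltn_trans b_large; nia. Qed.
Let Xnn : 1000 * (n * n) < 2 ^ b. Proof. by apply: leq_ltn_trans b_large; nia. Qed.
Let Xnm : 1000 * (n * m) + 1000 * m < 2 ^ b.
Proof. by apply: leq_ltn_trans b_large; nia. Qed.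

Ltac overflow := rewrite /=; repeat split; try done; lia.

Lemma size_es : size es = m.
Proof. by rewrite (perm_size es_E) cardE. Qed.

(** * Numbering of the nodes and scan of the edge list *)

Definition code (x : node) : nat := x.1 * n + x.2.

Lemma code_inj : injective code.
Proof.
move=> [d u] [d' u'] /eqP; rewrite /code /= mulnD_inj // => /andP [h /eqP /val_inj ->].
by case: d d' h => [] [].
Qed.

Lemma code_lt x : code x < 2 * n.
Proof. by rewrite /code; case: x => [[] u] /=; have := ltn_ord u; lia. Qed.

Lemma code_surj k : k < 2 * n -> exists x, code x = k.
Proof.
move=> hk; have [h | h] := ltnP k n.
  by exists (false, Ordinal h).
have h' : k - n < n by lia.
by exists (true, Ordinal h'); rewrite /code /= mul1n subnKC.
Qed.

Lemma code_div x : code x %/ n = x.1.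
Proof. by rewrite /code divnMDl ?divn_small ?addn0 // ltnW. Qed.

Lemma code_mod x : code x %% n = x.2.
Proof. by rewrite /code modnMDl modn_small. Qed.

(** The lists [N] are a parameter so that the predicate also describes the tables in the middle of
    the scan, for a prefix of the edges. *)
Definition represents (a : store) (N : node -> seq 'I_n) : Prop := forall x : node,
  [/\ a rdeg (code x) = size (N x),
      forall j u, j < size (N x) -> a rnb (code x * m + j) = nth u (N x) j,
      forall u : 'I_n, a rmat (code x * n + u) = (u \in N x)
    & a riw (code x) = \sum_(u <- N x) w u].

(** [ez] and [eu] are evaluated again after each write, hence the hypotheses on their values in
    every store. *)
Lemma add_arc_spec ez eu x (u : 'I_n) v (a : store) N :
  (forall a', ev b eps v a' ez = code x) -> (forall a', ev b eps v a' eu = u) ->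
  v xn = n -> v xm = m -> (forall u : 'I_n, a rw u = w u) ->
  represents a N -> (forall y, size (N y) <= m) -> size (N x) < m ->
  \sum_(u <- N x) w u + w u < 2 ^ b ->
  TRI (add_arc ez eu) v a 4 (fun v' a' => v' = v /\
    represents a' (fun y => if y == x then rcons (N y) u else N y)).
Proof.
move=> hz hu hn hm hw hr hN hx hs.
have hxl := code_lt x; have hul := ltn_ord u.
have [dx nx mx ix] := hr x.
have e1 a' : a' rdeg = a rdeg ->
    ev b eps v a' (ez [*] Var xm [+] Read rdeg ez) = code x * m + size (N x).
  move=> ea; rewrite /ev /= -/(ev b eps v a' ez) hz hm ea dx.
  rewrite (modn_small (m := code x * m)) ?modn_small //; nia.
have e2 a' : a' rdeg = a rdeg ->
    ev b eps v a' (Read rdeg ez [+] Const 1) = (size (N x)).+1.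
  move=> ea; rewrite /ev /= -/(ev b eps v a' ez) hz ea dx.
  by rewrite (modn_small (m := 1)) ?modn_small //; nia.
have e3 a' : ev b eps v a' (ez [*] Var xn [+] eu) = code x * n + u.
  rewrite /ev /= -/(ev b eps v a' ez) -/(ev b eps v a' eu) hz hn hu.
  rewrite (modn_small (m := code x * n)) ?modn_small //; nia.
have e4 a' : a' riw = a riw -> a' rw = a rw ->
    ev b eps v a' (Read riw ez [+] Read rw eu) = \sum_(u <- N x) w u + w u.
  move=> ea ew; rewrite /ev /= -/(ev b eps v a' ez) -/(ev b eps v a' eu) hz hu.
  by rewrite ea ew ix hw modn_small.
apply: tri_seq_write; rewrite e1 // hu.
apply: tri_seq_write; rewrite e2 // hz.
apply: tri_seq_write; rewrite e3 // {1}/ev /= (modn_small (m := 1)); last by lia.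
apply: tri_write; rewrite e4 // hz.
split=> // y /=; have [dy ny my iy] := hr y.
have cyx : (code y == code x) = (y == x) by apply/eqP/eqP => [/code_inj | ->].
split.
- by rewrite cyx; case: eqP => [-> | _] //; rewrite size_rcons.
- move=> j u0 hj.
  have hj' : j < m.
    by move: hj; case: eqP => [-> | _]; rewrite ?size_rcons => hj; have := hN y; lia.
  rewrite mulnD_inj // cyx; move: hj; case: eqP => [-> | _] hj /=; last exact: ny.
  rewrite nth_rcons; move: hj; rewrite size_rcons ltnS leq_eqVlt.
  case: ltngtP => //= h _; exact: nx.
- move=> u'; rewrite mulnD_inj // cyx.
  case: eqP => [-> | _] /=; last exact: my.
  by rewrite mem_rcons inE -val_eqE; case: ifP => //= _; exact: mx.
- rewrite cyx; case: eqP => [-> | _] //.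
  by rewrite -cats1 big_cat big_seq1.
Qed.

Definition nbrs (pre : seq ('I_n * 'I_n)) (x : node) : seq 'I_n :=
  if x.1 then [seq e.2 | e <- pre & e.1 == x.2]
  else [seq e.1 | e <- pre & e.2 == x.2].

Lemma nbrs_size pre x : size (nbrs pre x) <= size pre.
Proof. by rewrite /nbrs; case: ifP => _; rewrite size_map size_filter count_size. Qed.

Lemma nbrs_rcons pre e x : nbrs (rcons pre e) x =
  if x == (true, e.1) then rcons (nbrs pre x) e.2
  else if x == (false, e.2) then rcons (nbrs pre x) e.1 else nbrs pre x.
Proof.
case: x e => [[] u] [s t]; rewrite /nbrs /= filter_rcons /= xpair_eqE /= eq_sym;
by case: ifP => //=; rewrite map_rcons.
Qed.

Lemma mem_es e : (e \in es) = (e \in E).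
Proof. by rewrite (perm_mem es_E) mem_enum. Qed.

Lemma uniq_es : uniq es.
Proof. by rewrite (perm_uniq es_E) enum_uniq. Qed.

Lemma mem_nbrs x u : (u \in nbrs es x) = (u \in nin x).
Proof.
case: x => [[] y]; rewrite /nbrs /innbr /= !inE /=.
  apply/mapP/idP => [[[s t]]|h].
    by rewrite mem_filter mem_es /= => /andP [/eqP -> h] ->.
  by exists (y, u); rewrite // mem_filter mem_es eqxx.
apply/mapP/idP => [[[s t]]|h].
  by rewrite mem_filter mem_es /= => /andP [/eqP -> h] ->.
by exists (u, y); rewrite // mem_filter mem_es eqxx.
Qed.

Lemma uniq_nbrs k x : uniq (nbrs (take k es) x).
Proof.
have hu : uniq (take k es) by exact: take_uniq uniq_es.
rewrite /nbrs; case: (x.1); rewrite map_inj_in_uniq ?filter_uniq //;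
by move=> [s t] [s' t']; rewrite !mem_filter /= => /andP [/eqP -> _] /andP [/eqP -> _] ->.
Qed.

Lemma size_nbrs x : size (nbrs es x) = #|nin x|.
Proof.
have := uniq_nbrs (size es) x; rewrite take_size => /card_uniqP <-.
by apply: eq_card => u; rewrite mem_nbrs.
Qed.

Lemma sum_nbrs (F : 'I_n -> nat) x : \sum_(u <- nbrs es x) F u = \sum_(u in nin x) F u.
Proof.
have := uniq_nbrs (size es) x; rewrite take_size => hu.
by rewrite big_uniq //; apply: eq_bigl => u; rewrite mem_nbrs.
Qed.

Lemma sum_nbrs_take k x : \sum_(u <- nbrs (take k es) x) w u <= wsum w.
Proof.
rewrite big_uniq ?uniq_nbrs //= /wsum [leqRHS](bigID (mem (nbrs (take k es) x))) /=.
exact: leq_addr.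
Qed.

Definition input (v : env) (a : store) : Prop :=
  [/\ v xn = n, v xm = m, forall u : 'I_n, a rw u = w u,
      forall i e0, i < m -> a rt i = (nth e0 es i).1
    & forall i e0, i < m -> a rh i = (nth e0 es i).2].

Lemma scan_spec v (a : store) :
  input v a -> (forall r, 3 <= r -> forall i, a r i = 0) ->
  TRI scan v a (14 * m + 2) (fun v' a' => represents a' (nbrs es)).
Proof.
move=> [hn hm hw ht hh] ha.
apply: (@tri_for _ _ _ _ _ m (fun k v' a' => represents a' (nbrs (take k es))) (fun=> 10)).
- by lia.
- by lia.
- by [].
- move=> x; rewrite take0 /nbrs /=.
  have -> : (if x.1 then [::] else [::]) = [::] :> seq 'I_n by case: ifP.
  by split=> //=; rewrite ?ha ?big_nil // => u; rewrite ha.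
- by move=> k v' a' _ [hv _] _; rewrite /ev /= hv.
- move=> k v' a' hk [hv hr] hi hI.
  have hks : k < size es by rewrite size_es.
  have [e0 _] : exists e0 : 'I_n * 'I_n, True by case: (es) hks => // e; exists e.
  have hvn : v' xn = n by rewrite hv.
  have hvm : v' xm = m by rewrite hv.
  set e := nth e0 es k.
  have et : a' rt k = e.1 by rewrite hr // (ht k e0).
  have eh : a' rh k = e.2 by rewrite hr // (hh k e0).
  have hw' (u : 'I_n) : a' rw u = w u by rewrite hr.
  have etk : take k.+1 es = rcons (take k es) e by rewrite -take_nth.
  have sz y : size (nbrs (take k es) y) <= k.
    by apply: leq_trans (nbrs_size _ _) _; rewrite size_take; case: ifP => //; lia.
  have ne1 : (true, e.1) == (false, e.2) :> node = false by [].
  have hw1 u : w u <= wsum w.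
    by rewrite /wsum (bigD1 u) //= leq_addr.
  apply: tri_seq_assign; apply: tri_seq_assign.
  rewrite /ev /= hi eh et.
  apply: (@tri_seq _ _ _ _ _ 4 4) => //.
  have e1lt := ltn_ord e.1; have e2lt := ltn_ord e.2.
  apply: tri_post (leqnn _) _.
    apply: (add_arc_spec (x := (false, e.2)) (u := e.1) (N := nbrs (take k es))) => //.
    - by move=> y; apply: leq_trans (sz y) _; exact: ltnW.
    - by apply: leq_ltn_trans (sz _) _.
    - by have := sum_nbrs_take k (false, e.2); have := hw1 e.1; lia.
  move=> v1 a1 [_ fr] [-> hr1].
  apply: tri_post (leqnn _) _.
    apply: (add_arc_spec (x := (true, e.1)) (u := e.2) _ _ _ _ _ hr1) => //.
    - by move=> a2; rewrite evE /=; [rewrite hvn /code /= mul1n | split=> //; lia].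
    - by move=> u; rewrite fr.
    - by move=> y; case: ifP => _; rewrite ?size_rcons; have := sz y; lia.
    - by have := sz (true, e.1); rewrite ne1; lia.
    - by rewrite ne1; have := sum_nbrs_take k (true, e.1); have := hw1 e.2; lia.
  move=> v2 a2 _ [_ hr2] x; have := hr2 x; rewrite etk nbrs_rcons.
  by case: (eqVneq x (true, e.1)) => [-> | _]; rewrite ?ne1.
- by move=> v' a' _; rewrite -{1}size_es take_size.
- by rewrite sum_nat_const card_ord; lia.
Qed.

Lemma repr_deg a x : represents a (nbrs es) -> a rdeg (code x) = #|nin x|.
Proof. by move=> /(_ x) [-> _ _ _]; exact: size_nbrs. Qed.

Lemma repr_iw a x : represents a (nbrs es) -> a riw (code x) = iw E w x.
Proof. by move=> /(_ x) [_ _ _ ->]; exact: sum_nbrs. Qed.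

Lemma repr_mat a x (u : 'I_n) : represents a (nbrs es) ->
  a rmat (code x * n + u) = (u \in nin x).
Proof. by move=> /(_ x) [_ _ -> _]; rewrite mem_nbrs. Qed.

(** * Graphs with fewer edges than vertices *)

Lemma code_false (y : 'I_n) : code (false, y) = y.
Proof. by rewrite /code /= mul0n add0n. Qed.

Lemma output_label c s : vertex_cut E c ->
  (forall u : 'I_n, arrays s rout u = label c u) -> output n s = c.
Proof.
move=> /vertex_cutP [h _ _ _] hs.
case: c h hs => [[L S] T]; rewrite /label /output /read_triple /Lpart /Spart /Rpart /= => h hs.
congr (_, _, _); apply/setP => u; rewrite inE hs; have := h u;
by case: (u \in L); case: (u \in S); case: (u \in T).
Qed.

(** Take the least vertex without incoming edges: each smaller vertex receives an edge, whence
    [y <= m]. The search therefore takes O(m) steps even when n is much larger than m. *)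
Lemma source_exists : m < n ->
  exists y : 'I_n, [/\ y <= m, nin (false, y) = set0 &
    forall u : 'I_n, u < y -> 0 < #|nin (false, u)|].
Proof.
move=> hmn.
have hsum (k : nat) : (forall u : 'I_n, u < k -> 0 < #|nin (false, u)|) -> k <= n -> k <= m.
  move=> hk hkn; rewrite -(card_E E false).
  apply: (@leq_trans (\sum_(u < n | u < k) 1)).
    by rewrite (big_ord_narrow hkn) /= sum1_card card_ord.
  by rewrite big_mkcond; apply: leq_sum => u _; case: ifP => // /hk.
have ex : exists k, [exists y : 'I_n, (val y == k) && (#|nin (false, y)| == 0)].
  apply: contrapT => hne.
  have : n <= m.
    apply: hsum => // u _; rewrite lt0n; apply/negP => h0; apply: hne.
    by exists (val u); apply/existsP; exists u; rewrite eqxx.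
  by rewrite leqNgt hmn.
case: (ex_minnP ex) => k /existsP [y /andP [/eqP <- /eqP hy]] hmin.
have hlt (u : 'I_n) : u < y -> 0 < #|nin (false, u)|.
  move=> hu; rewrite lt0n; apply: contraL hu => h0.
  by rewrite -leqNgt; apply: hmin; apply/existsP; exists u; rewrite eqxx.
exists y; split=> //; last by apply/eqP; rewrite -cards_eq0 hy.
by apply: hsum => //; exact: ltnW.
Qed.

Lemma sparse_spec v (a : store) : m < n -> v xx = 0 -> represents a (nbrs es) ->
  TRI sparse v a (2 * m + 2) (fun v' a' => exists2 y : 'I_n, nin (false, y) = set0 &
    forall i, a' rout i = if i == y then 2 else a rout i).
Proof.
move=> hmn hx hr; have [y [hym hy hlt]] := source_exists hmn.
have hyn := ltn_ord y.
apply: (@tri_seq _ _ _ _ _ (2 * m + 1) 1); last by lia.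
apply: (@tri_while _ _ _ _ _ y (fun k v' a' => v' xx = k) (fun=> 1)) => //.
- move=> k v' a' hk [_ fr] hv.
  have hkn : k < n by lia.
  have hd : a rdeg k = #|nin (false, Ordinal hkn)| by rewrite -(repr_deg _ hr) code_false.
  split; first by rewrite /ev /= hv fr // hd -lt0n hlt.
  by apply: tri_assign; rewrite evE /= ?hv ?addn1 //; split=> //; lia.
- move=> v' a' [_ fr] hv; split.
    by rewrite /ev /= hv fr // -code_false repr_deg // hy cards0.
  apply: tri_write; exists y => // i.
  by rewrite /ev /= hv fr // modn_small //; lia.
- by rewrite sum_nat_const card_ord; lia.
Qed.

(** The output array is initially 0, the label of L, so the single label 2 written by [sparse]
    completes the star cut of the source, whose S is empty. *)
Lemma sparse_holds (Q : state -> Prop) (G : state -> bool) v (a : store) st r :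
  m < n -> v xx = 0 -> represents a (nbrs es) -> (forall i, a rout i = 0) ->
  (forall s, vertex_cut E (output n s) -> cut_weight w (output n s) = 0 ->
     queries s = 0 -> query_edges s = 0 -> steps s <= st + (2 * m + 2) ->
     Q s /\ (r <= (G s)%:R)%R) ->
  holds b eps Orc Q G [:: sparse] (State v a st 0 0) r.
Proof.
move=> hmn hx hr ha hQ; apply: holds_det; first exact: sparse_spec.
move=> v' a' t ht [y hy hout].
have hcut : vertex_cut E (star_cut E (false, y)).
  have hlt : #|nin (false, y)| < n.-1 by rewrite hy cards0; lia.
  by have /andP [] := star_cutP loopE hlt.
have eo : output n (State v' a' (st + t) 0 0) = star_cut E (false, y).
  apply: output_label => // u; rewrite /= hout ha /label /star_cut /Lpart /Spart /=.
  rewrite hy setU0 !inE val_eqE.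
  by case: eqP.
have [hQ1 hQ2] : Q (State v' a' (st + t) 0 0) /\
    (r <= (G (State v' a' (st + t) 0 0))%:R)%R.
  apply: hQ; rewrite ?eo //=; last by rewrite leq_add2l.
  by rewrite /cut_weight /star_cut /Spart /= hy big_set0.
exact: holds_nil.
Qed.

(** * Total weight, radius and mass *)

Lemma compute_total_spec v (a : store) : v xn = n -> v xtot = 0 ->
  (forall u : 'I_n, a rw u = w u) ->
  TRI compute_total v a (3 * n + 2) (fun v' a' => v' xtot = wsum w).
Proof.
move=> hn ht hw.
apply: (@tri_for _ _ _ _ _ n
  (fun k v' a' => v' xtot = \sum_(u < n | u < k) w u) (fun=> 1)) => //.
- by lia.
- by lia.
- by rewrite /= ht big_pred0.
- by move=> k v' a' _ [hv _] _; rewrite /ev /= hv.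
- move=> k v' a' hk [hv fr] hi hI; apply: tri_assign.
  have e : \sum_(u < n | u < k.+1) w u = \sum_(u < n | u < k) w u + w (Ordinal hk).
    exact: (big_lt_next addn (I := 'I_n) w (Ordinal hk) val_inj).
  have le : \sum_(u < n | u < k.+1) w u <= wsum w.
    by rewrite /wsum big_mkcond leq_sum // => u _; case: ifP.
  have er : a' rw k = w (Ordinal hk) by rewrite fr // -(hw (Ordinal hk)).
  rewrite evE /=; first by rewrite hI hi er -e.
  by split=> //; rewrite hI hi er -e; lia.
- by move=> v' a' _ ->; rewrite /wsum; apply: eq_bigl => u; rewrite ltn_ord.
- by rewrite sum_nat_const card_ord; lia.
Qed.

Lemma compute_radius_spec v (a : store) : v xn = n -> v xtot = wsum w -> v xrad = 0 ->
  0 < radius E w -> represents a (nbrs es) ->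
  TRI compute_radius v a (12 * n + 2) (fun v' a' => v' xrad = radius E w /\
    exists2 x, #|nin x| < n.-1 & v' xz = code x).
Proof.
move=> hn ht hr0 hpos hr.
pose F (x : node) := if #|nin x| < n.-1 then wsum w - iw E w x else 0.
(* While the running maximum is 0, no node has been recorded; the positivity of the radius ensures
   that one is recorded in the end. *)
apply: (@tri_for _ _ _ _ _ (2 * n) (fun k v' a' => v' xrad = \max_(x | code x < k) F x /\
   (0 < v' xrad -> exists2 x, #|nin x| < n.-1 & v' xz = code x)) (fun=> 4)) => //.
- by lia.
- by lia.
- by rewrite /= hr0 big_pred0.
- move=> k v' a' _ [hv _] _; have h0 : v' xn = n by rewrite hv.
  by rewrite evE /= h0 //; split=> //; lia.
- move=> k v' a' hk [hv fr] hi [hI1 hI2].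
  have [x hx] := code_surj hk.
  have e : \max_(x | code x < k.+1) F x = maxn (\max_(x | code x < k) F x) (F x).
    by rewrite -hx; exact: big_lt_next code_inj.
  have hn' : v' xn = n by rewrite hv.
  have ht' : v' xtot = wsum w by rewrite hv.
  have hd : a' rdeg k = #|nin x| by rewrite fr // -hx repr_deg.
  have hiw : a' riw k = iw E w x by rewrite fr // -hx repr_iw.
  apply: tri_if; (rewrite evE /=; last by overflow); rewrite hi hd hn' subn1; last first.
    move=> hnx; apply: tri_skip; rewrite /= e /F.
    by case: ltnP hnx => // _ _; rewrite maxn0.
  move=> hnx.
  have hnx' : #|nin x| < n.-1 by case: ltnP hnx.
  have sub : wsum w - iw E w x < 2 ^ b by lia.
  have es1 : ev b eps v' a' (Var xtot [-] Read riw (Var xv)) = wsum w - iw E w x.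
    by rewrite evE /= hi ht' hiw.
  apply: tri_if; (rewrite evE /=; last by rewrite hi hiw ht'; overflow);
    rewrite hi hiw ht' hI1 => hlt.
    apply: tri_seq_assign; apply: tri_assign; rewrite es1 /ev /= hi.
    split; last by exists x.
    by rewrite e /F hnx'; case: ltnP hlt => // h _; rewrite (maxn_idPr (ltnW h)).
  apply: tri_skip; rewrite /= e /F hnx'; split=> //.
  by rewrite hI1 (maxn_idPl _) //; case: ltnP hlt.
- move=> v' a' _ [h1 h2].
  have e : v' xrad = radius E w.
    rewrite h1 /radius [RHS]big_mkcond; apply: eq_bigl => x; exact: code_lt.
  by split=> //; apply: h2; rewrite e.
- by rewrite sum_nat_const card_ord; lia.
Qed.

Lemma mass_le_wsum : mass E w <= 2 * wsum w.
Proof. by rewrite massE leq_mul2l /=; apply: leq_sum => u _; exact: aw_le. Qed.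

Lemma compute_mass_spec v (a : store) : v xn = n -> v xrad = radius E w -> v xmass = 0 ->
  radius E w <= wsum w ->
  (forall u : 'I_n, a rw u = w u) -> (forall i, a raw i = 0) ->
  TRI compute_mass v a (12 * n + 2) (fun v' a' => v' xmass = mass E w /\
    forall x, a' raw (code x) = aw E w x.2).
Proof.
move=> hn hrad hm0 hrw hw ha.
apply: (@tri_for _ _ _ _ _ (2 * n) (fun k v' a' =>
   v' xmass = \sum_(x | code x < k) aw E w x.2 /\
   forall x, a' raw (code x) = if code x < k then aw E w x.2 else 0) (fun=> 4)) => //.
- by lia.
- by lia.
- by rewrite /= hm0 big_pred0.
- move=> k v' a' _ [hv _] _; have h0 : v' xn = n by rewrite hv.
  by rewrite evE /= h0 //; split=> //; lia.
- move=> k v' a' hk [hv fr] hi [hI1 hI2].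
  have [x hx] := code_surj hk.
  have e : \sum_(x | code x < k.+1) aw E w x.2 =
      \sum_(x | code x < k) aw E w x.2 + aw E w x.2.
    by rewrite -hx; exact: (big_lt_next addn (fun x => aw E w x.2) _ code_inj).
  have hn' : v' xn = n by rewrite hv.
  have hrad' : v' xrad = radius E w by rewrite hv.
  have hkm : k %% n = x.2 by rewrite -hx code_mod.
  have hwx : a' rw x.2 = w x.2 by rewrite fr.
  have le : \sum_(x | code x < k.+1) aw E w x.2 <= 2 * wsum w.
    by apply: leq_trans mass_le_wsum; rewrite /mass big_mkcond leq_sum // => y _; case: ifP.
  have xlt := ltn_ord x.2.
  have er : ev b eps v' a' (Read rw (Var xv [%] Var xn)) = w x.2.
    by rewrite evE /= hi hn' hkm //; overflow.
  apply: tri_if; (rewrite evE /=; last by rewrite hi hn' hkm hwx hrad'; overflow);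
    rewrite hi hn' hkm hwx hrad' addn1 ltnS => hle.
    have eaw : aw E w x.2 = w x.2 by rewrite /aw; case: leqP hle.
    apply: tri_seq_write; apply: tri_assign; rewrite er [ev _ _ _ _ (Var xv)]/ev /= hi.
    rewrite evE /= hi hn' hkm; last first.
      split=> //; first by overflow.
      by rewrite hwx hI1 -eaw -e; apply: leq_ltn_trans le _; lia.
    rewrite hwx hI1 e eaw; split=> // y; rewrite -hx.
    case: (eqVneq y x) => [-> | ne]; first by rewrite eqxx ltnSn eaw.
    rewrite (inj_eq code_inj) (negPf ne) hI2 -hx ltnS [in RHS]leq_eqVlt.
    by rewrite (inj_eq code_inj) (negPf ne).
  have eaw : aw E w x.2 = 0 by rewrite /aw; case: leqP hle.
  apply: tri_skip; rewrite /= e eaw addn0; split=> // y; rewrite hI2 -hx ltnS [in RHS]leq_eqVlt.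
  rewrite (inj_eq code_inj); case: (eqVneq y x) => [-> | //].
  by rewrite eaw if_same.
- by move=> v' a' _ [-> h]; split=> [|x]; [apply: eq_bigl => x | rewrite h]; rewrite code_lt.
- by rewrite sum_nat_const card_ord; lia.
Qed.

(** * One round: measuring, listing and recording a rooted query *)

Definition opp_base (x : node) : nat := (~~ x.1) * n.

Lemma count_edges_spec v (a : store) x : v xn = n -> v xz = code x ->
  represents a (nbrs es) -> v xU + root_size E x < 2 ^ b ->
  TRI count_edges v a (5 * n + 7) (fun v' a' =>
    [/\ v' xd = x.1, v' xy = x.2, v' xo = opp_base x & v' xU = v xU + root_size E x]).
Proof.
move=> hn hz hr hU.
have hcx := code_lt x; have hx2 := ltn_ord x.2.
have le k : \sum_(u < n | u < k) kept E x u <= root_size E x.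
  by rewrite /root_size big_mkcond leq_sum // => u _; case: ifP.
rewrite (_ : 5 * n + 7 = (5 * n + 3).+4); last by lia.
apply: tri_seq_assign.
have -> : ev b eps v a (Var xz [/] Var xn) = x.1.
  rewrite evE /= hz hn code_div //; split=> //; case: (x.1) => /=; lia.
apply: tri_seq_assign.
have -> : ev b eps (upd v xd x.1) a (Var xz [%] Var xn) = x.2.
  by rewrite evE /= hz hn code_mod //; split=> //; lia.
apply: tri_seq_assign.
have -> : ev b eps (upd (upd v xd x.1) xy x.2) a ((Const 1 [-] Var xd) [*] Var xn) =
    opp_base x.
  rewrite evE /= hn; first by rewrite /opp_base; case: (x.1).
  by case: (x.1) => /=; overflow.
apply: tri_seq_assign; rewrite [ev _ _ _ _ (Const 0)]/ev /= mod0n.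
apply: (@tri_seq _ _ _ _ _ (5 * n + 2) 1); last by lia.
apply: (@tri_for _ _ _ _ _ n
  (fun k v' a' => v' xc = \sum_(u < n | u < k) kept E x u) (fun=> 3)) => //.
- by lia.
- by lia.
- by rewrite /= big_pred0.
- by move=> k v' a' _ [hv _] _; rewrite /ev /= hv.
- move=> k v' a' hk [hv fr] hi hI.
  pose u := Ordinal hk; pose y : node := (~~ x.1, u).
  have e : \sum_(u < n | u < k.+1) kept E x u = \sum_(u < n | u < k) kept E x u + kept E x u.
    exact: (big_lt_next addn (I := 'I_n) (kept E x) u val_inj).
  have lek := le k.+1; rewrite e in lek.
  have hn' : v' xn = n by rewrite hv.
  have hz' : v' xz = code x by rewrite hv.
  have hy' : v' xy = x.2 by rewrite hv.
  have ho' : v' xo = opp_base x by rewrite hv.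
  have hm' : a' rmat (code x * n + k) = (u \in nin x) by rewrite fr // (repr_mat x u hr).
  have hd' : a' rdeg (opp_base x + k) = #|nin (~~ x.1, u)| by rewrite fr // (repr_deg y hr).
  have hob : opp_base x <= n by rewrite /opp_base; case: (x.1) => /=; lia.
  have hcn : code x * n + k < 2 ^ b by nia.
  have hcn' : code x * n < 2 ^ b by lia.
  apply: tri_if; (rewrite evE /=; last by rewrite hz' hn' hi; overflow);
    rewrite hz' hn' hi hm' => hmat.
    have eF : kept E x u = 1 by rewrite /kept; case: (u \in _) hmat.
    apply: tri_assign; rewrite evE /= hI; first by rewrite e eF.
    split=> //; first by lia.
    by rewrite eF in lek; apply: leq_ltn_trans lek _; lia.
  have nm : u \in nin x = false by case: (u \in _) hmat.
  apply: tri_if; (rewrite evE /=; last by rewrite hi hy'; overflow); rewrite hi hy' => heq.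
    have eu : u == x.2 by rewrite -val_eqE /=; case: (k == _) heq.
    by apply: tri_skip; rewrite /= hI e /kept nm eu addn0.
  have eu : u == x.2 = false by rewrite -val_eqE /=; case: (k == _) heq.
  have eF : kept E x u = #|nin (~~ x.1, u)| by rewrite /kept nm eu.
  apply: tri_assign; rewrite evE /= ho' hi hd' hI; first by rewrite e eF.
  split=> //; first by overflow.
  by rewrite -eF; apply: leq_ltn_trans lek _; lia.
- move=> v' a' [hv fr] hI; apply: tri_assign.
  have eI : v' xc = root_size E x by rewrite hI; apply: eq_bigl => u; rewrite ltn_ord.
  have hU' : v' xU = v xU by rewrite hv.
  split=> /=; [by rewrite hv | by rewrite hv | by rewrite hv |].
  by rewrite evE /= eI hU' //; overflow.
- by rewrite sum_nat_const card_ord; lia.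
Qed.

(** The heads that [emit] lists for the tail [u], in order; [arcs_graph] identifies the whole list
    with [root_graph]. *)
Definition outs (x : node) (u : 'I_n) : seq 'I_n :=
  if u \in nin x then [:: x.2]
  else if u == x.2 then [::] else nbrs es (~~ x.1, u).

Definition block (x : node) (u : 'I_n) : seq (nat * nat) :=
  [seq (val u, val u') | u' <- outs x u].

Definition arcs (x : node) : seq (nat * nat) :=
  flatten [seq block x u | u <- enum 'I_n].

Definition listed (a : store) (k : nat) : seq (nat * nat) :=
  [seq (a rqt i, a rqh i) | i <- iota 0 k].

Lemma size_outs x u : size (outs x u) = kept E x u.
Proof. by rewrite /outs /kept; case: ifP => // _; case: ifP => // _; exact: size_nbrs. Qed.

Lemma size_outs_le x u : size (outs x u) <= n.
Proof.
rewrite size_outs /kept; case: ifP => _; first by lia.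
by case: ifP => // _; apply: leq_trans (max_card _) _; rewrite card_ord.
Qed.

Lemma size_arcs x : size (arcs x) = root_size E x.
Proof.
rewrite size_flatten /shape -map_comp sumnE big_map big_enum /=.
by apply: eq_bigr => u _; rewrite size_map size_outs.
Qed.

Lemma push_spec eu eu' v (a : store) (u u' : nat) :
  ev b eps v a eu = u ->
  (forall a', (forall r i, r != rqt -> a' r i = a r i) -> ev b eps v a' eu' = u') ->
  (v xk).+1 < 2 ^ b ->
  TRI (push eu eu') v a 3 (fun v' a' => [/\ v' = upd v xk (v xk).+1 &
    listed a' (v xk).+1 = rcons (listed a (v xk)) (u, u')]).
Proof.
move=> hu hu' hk.
apply: tri_seq_write; rewrite hu; apply: tri_seq_write; rewrite hu'; last first.
  by move=> r i /negPf /= ->.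
apply: tri_assign; rewrite evE /=; last by overflow.
rewrite addn1 /ev /=; split=> //.
rewrite /listed -[in iota _ _.+1]addn1 iotaD map_cat cats1 /= eqxx; congr rcons.
by apply/eq_in_map => i; rewrite mem_iota => /andP [_ hi]; rewrite (ltn_eqF hi).
Qed.

Lemma emit_spec v (a : store) x : v xn = n -> v xm = m -> v xz = code x -> v xy = x.2 ->
  v xo = opp_base x -> represents a (nbrs es) ->
  TRI emit v a (5 * root_size E x + 6 * n + 3) (fun v' a' =>
    v' xk = root_size E x /\ listed a' (root_size E x) = arcs x).
Proof.
move=> hn hm hz hy ho hr; have hcx := code_lt x; have hx2 := ltn_ord x.2.
pose P k := flatten [seq block x u | u <- take k (enum 'I_n)].
(* The time of an iteration depends on the degree of its tail; summed over all tails it is linear in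
   n and in the number of listed edges. The bound [k * n] in the invariant excludes an overflow of
   [xk]. *)
pose T (k : nat) := if insub k is Some u then 5 * size (outs x u) + 4 else 0.
rewrite addn3; apply: tri_seq_assign; rewrite [ev _ _ _ _ (Const 0)]/ev /= mod0n.
apply: (@tri_for _ _ _ _ _ n
  (fun k v' a' => listed a' (v' xk) = P k /\ v' xk <= k * n) T) => //.
- by lia.
- by lia.
- by rewrite /P take0.
- by move=> k v' a' _ [hv _] _; rewrite /ev /= hv.
- move=> k v' a' hk [hv fr] hi [hI1 hI2].
  pose u := Ordinal hk; pose y : node := (~~ x.1, u).
  have hT : T k = 5 * size (outs x u) + 4 by rewrite /T -[k]/(val u) valK.
  have eP : P k.+1 = P k ++ block x u.
    rewrite /P (take_nth u) ?size_enum_ord // map_rcons -cats1 flatten_cat /= cats0.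
    by rewrite (_ : nth u _ k = u) //; apply: val_inj; rewrite /= nth_enum_ord.
  have hn' : v' xn = n by rewrite hv.
  have hm1 : v' xm = m by rewrite hv.
  have hz' : v' xz = code x by rewrite hv.
  have hy' : v' xy = x.2 by rewrite hv.
  have ho' : v' xo = opp_base x by rewrite hv.
  have hm' : a' rmat (code x * n + k) = (u \in nin x) by rewrite fr // (repr_mat x u hr).
  have hd' : a' rdeg (opp_base x + k) = size (nbrs es y).
    by rewrite fr // (repr_deg y hr) size_nbrs.
  have hob : opp_base x <= n by rewrite /opp_base; case: (x.1) => /=; lia.
  have hkn : k * n + n <= n * n by rewrite addnC -mulSn leq_mul2r hk orbT.
  have hcxn : code x * n <= 2 * n * n by rewrite leq_mul2r ltnW ?orbT.
  have hcn : code x * n + k < 2 ^ b by lia.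
  have hcn' : code x * n < 2 ^ b by lia.
  rewrite hT addn4; apply: tri_if; (rewrite evE /=; last by rewrite hz' hn' hi; overflow);
    rewrite hz' hn' hi hm' => hmat.
    have eo : outs x u = [:: x.2] by rewrite /outs; case: (u \in _) hmat.
    apply: tri_post.
    + apply: (push_spec (u := u) (u' := x.2)) => //.
      by lia.
    + by lia.
    move=> v1 a1 _ [-> e1] /=; rewrite e1 hI1 eP /block eo cats1; split=> //.
    by rewrite mulSn; lia.
  have nm : u \in nin x = false by case: (u \in _) hmat.
  apply: tri_if; (rewrite evE /=; last by rewrite hi hy'; overflow); rewrite hi hy' => heq.
    have eu : u == x.2 by rewrite -val_eqE /=; case: (k == _) heq.
    apply: tri_skip; rewrite /= hI1 eP /block /outs nm eu cats0; split=> //.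
    by rewrite mulSn; lia.
  have eu : u == x.2 = false by rewrite -val_eqE /=; case: (k == _) heq.
  have eo : outs x u = nbrs es y by rewrite /outs nm eu.
  have szn := size_outs_le x u; rewrite eo in szn.
  apply: (@tri_for _ _ _ _ _ (size (nbrs es y)) (fun j v1 a1 =>
     listed a1 (v1 xk) = P k ++ take j (block x u) /\ v1 xk <= k * n + j) (fun=> 3)) => //.
  + by lia.
  + by lia.
  + by rewrite /= take0 cats0 addn0.
  + move=> j v1 a1 _ [hv1 fr1] _; rewrite evE /= !hv1 // ho' hi; first by rewrite fr1.
    by overflow.
  + move=> j v1 a1 hj [hv1 fr1] hij [hJ1 hJ2].
    have hjb : j < size (block x u) by rewrite size_map eo.
    have hsm : size (nbrs es y) <= m by rewrite -size_es; exact: nbrs_size.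
    have ecy : opp_base x + k = code y by [].
    have hcy := code_lt y.
    have hcym : code y * m <= 2 * n * m by rewrite leq_mul2r ltnW ?orbT.
    have [_ hnb _ _] := hr y.
    have ho1 : v1 xo = opp_base x by rewrite hv1.
    have hi1 : v1 xu = k by rewrite hv1.
    have hm2 : v1 xm = m by rewrite hv1.
    apply: tri_post.
    * apply: (push_spec (u := u) (u' := nth u (nbrs es y) j)) => //.
      - move=> a2 ha2; rewrite evE /=.
          by rewrite ho1 hi1 hm2 hij ecy ha2 // fr1 // fr // (hnb _ u).
        by rewrite ho1 hi1 hm2 hij ecy; repeat split=> //; lia.
      - by lia.
    * by [].
    move=> v2 a2 _ [-> e1] /=; rewrite e1 hJ1 (take_nth (0, 0)) // rcons_cat; split.
      by congr (_ ++ rcons _ _); rewrite /block eo (nth_map u).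
    by lia.
  + move=> v1 a1 _ [hJ1 hJ2]; rewrite /= hJ1 eP; split; last by rewrite mulSn; lia.
    by rewrite take_oversize // size_map eo.
  + by rewrite sum_nat_const card_ord eo; lia.
- move=> v' a' _ [hI _].
  have e : P n = arcs x by rewrite /P take_oversize // size_enum_ord.
  have ek : v' xk = root_size E x.
    by rewrite -size_arcs -e -hI size_map size_iota.
  by rewrite -ek -e.
- rewrite (eq_bigr (fun u : 'I_n => 5 * kept E x u + 6)).
    rewrite big_split /= -big_distrr /= sum_nat_const card_ord.
    by rewrite -/(root_size E x) addn2 [6 * n]mulnC.
  by move=> u _; rewrite /T valK size_outs; lia.
Qed.

Lemma mem_outs x u u' : (u' \in outs x u) = ((u, u') \in root_graph E x).
Proof.
rewrite inE /= /outs; case: ifP => [hu | hu].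
  rewrite inE andbF orbF; case: eqP => [-> | _]; last by rewrite andbF.
  by move: hu; rewrite inE => ->.
case: eqP => [-> | ne] /=; last first.
  by rewrite orbT andbT mem_nbrs -nin_sym inE.
by rewrite orbF in_nil; case: eqP => [-> | _]; rewrite ?dirE_loop ?andbF.
Qed.

Lemma arcs_legal x : legal_list n (arcs x).
Proof.
apply/andP; split; last first.
  apply/allP => e /flatten_mapP [u _] /mapP [u']; rewrite mem_outs => h -> /=.
  rewrite !ltn_ord /=; apply: contraTneq h => /val_inj ->.
  by rewrite inE dirE_loop.
have := @allpairs_uniq_dep 'I_n (fun=> 'I_n) (nat * nat)%type
  (fun u u' => (val u, val u')) (enum 'I_n) (outs x).
rewrite /allpairs_dep; apply; first exact: enum_uniq.
- move=> u _; rewrite /outs; case: ifP => // _; case: ifP => // _.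
  by have := uniq_nbrs (size es) (~~ x.1, u); rewrite take_size.
- move=> [u1 u1'] [u2 u2'] _ _ /= [] /val_inj e1 /val_inj e2.
  by rewrite /= in e1 e2; subst.
Qed.

Lemma arcs_graph x : listed_graph n (arcs x) = root_graph E x.
Proof.
apply/setP => -[u u']; rewrite [LHS]inE /= -mem_outs.
apply/flatten_mapP/idP => [[u1 _ /mapP [u2 h [/val_inj -> /val_inj ->]]] // | h].
by exists u; rewrite ?mem_enum //; apply/mapP; exists u'.
Qed.

(** The flip exchanges the labels 0 and 2 and fixes 1; this arithmetic form is the expression that
    [keep] evaluates. *)
Lemma label_flip d c u : vertex_cut (dirE E d) c ->
  label (flip d c) u = d * (2 - label c u) + (1 - d) * label c u.
Proof.
move=> /vertex_cutP [/(_ u) h _ _ _]; case: c h => [[L S] T].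
rewrite /label /flip /Lpart /Spart /Rpart /=; case: d => /=;
by case: (u \in L); case: (u \in S); case: (u \in T).
Qed.

Lemma label_le c (u : 'I_n) : label c u <= 2.
Proof. by rewrite /label; case: ifP => // _; case: ifP. Qed.

Lemma keep_spec v (a : store) (d : bool) c : v xn = n -> v xd = d ->
  (forall u : 'I_n, a rw u = w u) -> vertex_cut (dirE E d) c ->
  (forall u : 'I_n, a rans u = label c u) ->
  TRI keep v a (7 * n + 7) (fun v' a' =>
    if cut_weight w c < v xbw
    then v' xbw = cut_weight w c /\ forall u : 'I_n, a' rout u = label (flip d c) u
    else v' xbw = v xbw /\ forall u : 'I_n, a' rout u = a rout u).
Proof.
move=> hn hd hw hc ha.
have eS u : (label c u == 1) = (u \in Spart c).
  have /vertex_cutP [/(_ u) h _ _ _] := hc; rewrite /label.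
  by move: h; case: (u \in Lpart c); case: (u \in Spart c).
pose F u := if u \in Spart c then w u else 0.
have eF : \sum_u F u = cut_weight w c by rewrite /cut_weight [RHS]big_mkcond.
have le k : \sum_(u < n | u < k) F u <= cut_weight w c.
  by rewrite -eF [leqLHS]big_mkcond leq_sum // => u _; case: ifP.
have lew := cut_weight_le_wsum w c.
rewrite (_ : 7 * n + 7 = ((4 * n + 2) + (3 * n + 4)).+1); last by lia.
apply: tri_seq_assign; rewrite [ev _ _ _ _ (Const 0)]/ev /= mod0n.
apply: tri_seq (leqnn _).
apply: (@tri_for _ _ _ _ _ n
  (fun k v' a' => v' xcw = \sum_(u < n | u < k) F u) (fun=> 2)) => //.
- by lia.
- by lia.
- by rewrite /= big_pred0.
- by move=> k v' a' _ [hv _] _; rewrite /ev /= hv.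
- move=> k v' a' hk [hv fr] hi hI; pose u := Ordinal hk.
  have e : \sum_(u < n | u < k.+1) F u = \sum_(u < n | u < k) F u + F u.
    exact: (big_lt_next addn (I := 'I_n) F u val_inj).
  have lek := le k.+1; rewrite e in lek.
  have hans : a' rans k = label c u by rewrite fr // -ha.
  have hwk : a' rw k = w u by rewrite fr // -hw.
  apply: tri_if; (rewrite evE /=; last by rewrite hi hans; overflow);
    rewrite hi hans eS => hS.
    have eFu : F u = w u by rewrite /F; case: (u \in _) hS.
    apply: tri_assign; rewrite evE /= hI hi hwk; first by rewrite e eFu.
    by split=> //; rewrite -eFu; apply: leq_ltn_trans lek _; lia.
  have eFu : F u = 0 by rewrite /F; case: (u \in _) hS.
  by apply: tri_skip; rewrite /= hI e eFu addn0.
- move=> v' a' [hv fr] hI.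
  have eI : v' xcw = cut_weight w c.
    by rewrite hI -eF; apply: eq_bigl => u; rewrite ltn_ord.
  have hbw : v' xbw = v xbw by rewrite hv.
  have hn' : v' xn = n by rewrite hv.
  have hd' : v' xd = d by rewrite hv.
  have ha' (u : 'I_n) : a' rans u = label c u by rewrite fr.
  rewrite addn4; apply: tri_if; (rewrite evE /=; last by rewrite eI; overflow);
    rewrite eI hbw => hlt; last first.
    apply: tri_skip; have -> : cut_weight w c < v 15 = false by case: (_ < _) hlt.
    by split=> // u; rewrite fr.
  have -> : cut_weight w c < v 15 by case: (_ < _) hlt.
  apply: tri_seq_assign; rewrite /ev /= eI.
  apply: (@tri_for _ _ _ _ _ n (fun k v1 a1 => forall u : 'I_n, u < k ->
     a1 rout u = label (flip d c) u) (fun=> 1)) => //.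
  + by lia.
  + by lia.
  + by move=> k v1 a1 _ [hv1 _] _; rewrite /ev /= hv1.
  + move=> k v1 a1 hk [hv1 fr1] hi1 hJ; pose u := Ordinal hk; apply: tri_write => u1 hu1.
    have hans : a1 rans k = label c u by rewrite fr1 // -ha'.
    have hd1 : v1 xd = d by rewrite hv1.
    have lab := label_le c u.
    rewrite [ev _ _ _ _ (Var xv)]/ev /= hi1 evE /= hi1 hd1 hans -?label_flip //; last first.
      have := label_le (flip d c) u; case: (d) => /= hl; repeat split=> //; lia.
    case: eqP => [eu | ne]; first by congr (label _ _); apply: val_inj.
    by apply: hJ; move: hu1; rewrite ltnS leq_eqVlt; case: eqP.
  + move=> v1 a1 [hv1 fr1] hJ; split; first by rewrite hv1.
    by move=> u; apply: hJ.
  + by rewrite sum_nat_const card_ord; lia.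
- by rewrite sum_nat_const card_ord; lia.
Qed.

(** * Drawing a node with probability proportional to its weight *)

Fixpoint wpick (l : seq nat) (r : nat) : nat :=
  if l is x :: l' then if r < x then 0 else (wpick l' (r - x)).+1 else 0.

(** Laying intervals of the lengths in [l] end to end, exactly [nth 0 l k] values of [r] fall in the
    interval of index [k]. A uniform [r] thus selects [k] with probability proportional to its
    weight. *)
Lemma wpick_sum (l : seq nat) (f : nat -> R) :
  (\sum_(r < sumn l) f (wpick l r) = \sum_(k < size l) (nth 0%N l k)%:R * f k)%R.
Proof.
elim: l f => [|x l IH] f; first by rewrite !big_ord0.
rewrite /= big_split_ord big_ord_recl /=; congr (_ + _)%R.
  by rewrite (eq_bigr (fun=> f 0)) ?sumr_const ?card_ord ?mulr_natl // => i _; rewrite ltn_ord.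
rewrite -(IH (fun k => f k.+1)); apply: eq_bigr => i _.
by rewrite ltnNge leq_addr /= addKn.
Qed.

Lemma wpick_lt (l : seq nat) r : r < sumn l -> wpick l r < size l.
Proof.
elim: l r => //= x l IH r hr; case: (ltnP r x) => h //; rewrite ltnS; apply: IH; lia.
Qed.

Definition nodes : seq node :=
  [seq (false, u) | u <- enum 'I_n] ++ [seq (true, u) | u <- enum 'I_n].

Definition weights : seq nat := [seq aw E w x.2 | x <- nodes].

Lemma size_nodes : size nodes = 2 * n.
Proof.
have h (f : 'I_n -> node) : size [seq f u | u <- enum 'I_n] = n.
  by rewrite size_map size_enum_ord.
by rewrite size_cat !h mul2n addnn.
Qed.

Lemma nth_nodes x0 x : nth x0 nodes (code x) = x.
Proof.
rewrite /nodes nth_cat size_map size_enum_ord; case: x => [[] u]; rewrite /code /=.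
  rewrite mul1n ltnNge leq_addr /= addKn (nth_map u) ?size_enum_ord //.
  by rewrite nth_ord_enum.
by rewrite mul0n add0n ltn_ord (nth_map u) ?size_enum_ord // nth_ord_enum.
Qed.

Lemma nodes_perm : perm_eq nodes (index_enum node).
Proof.
apply: uniq_perm; rewrite ?index_enum_uniq //.
  have hu d : uniq [seq (d, u) | u <- enum 'I_n].
    by rewrite map_inj_uniq ?enum_uniq // => u v [].
  rewrite cat_uniq; apply/and3P; split=> //.
  by apply/hasPn => _ /mapP [u _ ->]; apply/negP => /mapP [].
move=> x; rewrite mem_index_enum; case: x => [[] u]; rewrite mem_cat; apply/orP.
  by right; apply/mapP; exists u; rewrite ?mem_enum.
by left; apply/mapP; exists u; rewrite ?mem_enum.
Qed.

Lemma sumn_weights : sumn weights = mass E w.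
Proof. by rewrite sumnE big_map (perm_big _ nodes_perm). Qed.

Lemma nth_weights x : nth 0 weights (code x) = aw E w x.2.
Proof. by rewrite (nth_map x) ?nth_nodes // size_nodes code_lt. Qed.

Lemma pick_mean (f : nat -> R) :
  (\sum_(r < mass E w) f (wpick weights r) = \sum_(x : node) (aw E w x.2)%:R * f (code x))%R.
Proof.
rewrite -sumn_weights wpick_sum size_map size_nodes.
rewrite (reindex (fun x : node => Ordinal (code_lt x))) /=.
  by apply: eq_bigr => x _; rewrite nth_weights.
have hc (k : 'I_(2 * n)) : exists x, code x == k.
  by have [x hx] := code_surj (ltn_ord k); exists x; rewrite hx.
exists (fun k => xchoose (hc k)) => [x _ | k _].
  exact/code_inj/eqP/(xchooseP (hc (Ordinal (code_lt x)))).
by apply: val_inj; apply/eqP; exact: (xchooseP (hc k)).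
Qed.

Lemma pick_spec v (a : store) : v xr < mass E w ->
  (forall x, a raw (code x) = aw E w x.2) ->
  TRI pick v a (6 * n + 2) (fun v' a' => v' xz = wpick weights (v xr)).
Proof.
move=> hr ha; have hml := mass_le_wsum.
have haw k : k < 2 * n -> a raw k = nth 0 weights k.
  by move=> hk; have [x <-] := code_surj hk; rewrite ha nth_weights.
have sw : size weights = 2 * n by rewrite size_map size_nodes.
have hN : wpick weights (v xr) < 2 * n by rewrite -sw; apply: wpick_lt; rewrite sumn_weights.
rewrite addn2; apply: tri_seq_assign; rewrite [ev _ _ _ _ (Const 0)]/ev /= mod0n.
(* Subtracting the weights already passed reduces the search to the same search in the rest of the
   list, where [r] stays below the remaining sum. *)
apply: (@tri_while _ _ _ _ _ (wpick weights (v xr)) (fun k v' a' =>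
  [/\ v' xz = k, v' xr < sumn (drop k weights), v' xr <= v xr &
      wpick weights (v xr) = k + wpick (drop k weights) (v' xr)]) (fun=> 2)) => //.
- by rewrite /= drop0 sumn_weights.
- move=> k v' a' hk [hv fr] [hz hs hle hp].
  have hk2 : k < 2 * n by lia.
  have hd : drop k weights = nth 0 weights k :: drop k.+1 weights by rewrite -drop_nth // sw.
  have hak : a' raw k = nth 0 weights k by rewrite fr // haw.
  rewrite hd /= in hs hp; set x := nth 0 weights k in hs hp hak *.
  have hlt : v' xr < x = false by move: hp; case: ltnP => // _; lia.
  rewrite hlt in hp.
  split; first by rewrite evE /= hz hak; [rewrite addn1 ltnS leqNgt hlt | overflow].
  apply: tri_seq_assign; apply: tri_assign.
  rewrite [ev _ _ v' _ _]evE /= hz hak; last by split=> //; lia.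
  rewrite evE /= hz ?addn1; last by overflow.
  by split=> //; lia.
- move=> v' a' [hv fr] [hz hs hle hp]; split=> //.
  set k := wpick weights (v xr) in hz hs hp hN.
  have hd : drop k weights = nth 0 weights k :: drop k.+1 weights by rewrite -drop_nth // sw.
  have hak : a' raw k = nth 0 weights k by rewrite fr // haw.
  rewrite hd /= in hs hp.
  have hlt : v' xr < nth 0 weights k by move: hp; case: ltnP => // _; lia.
  by rewrite evE /= hz hak; [rewrite addn1 ltnS leqNgt hlt | overflow].
- by rewrite sum_nat_const card_ord; lia.
Qed.

(** * Number of rounds and probability of success *)

Hypothesis eps_ge0 : (0 <= eps)%R.
Hypothesis orcP : rooted_mincut_oracle w eps Orc.
Hypothesis m_ge_n : n <= m.
Variable c0 : triple n.
Hypothesis c0_cut : vertex_cut E c0.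
Hypothesis c0_opt : cut_weight w c0 = OPT w E.

Notation rad := (radius E w).
Notation K := (mass E w).
Notation g := (root_size E).

(** The first round uses the node recorded with the radius; the other [6 * (K %/ rad) + 6] rounds
    use drawn roots. *)
Definition rounds : nat := 6 * (K %/ rad) + 7.

Let rad_gt0 : 0 < rad := radius_gt0 loopE w_gt0 c0_cut.
Let rad_le_K : rad <= K := mass_ge w loopE c0_cut.
Let K_gt0 : 0 < K. Proof. exact: leq_trans rad_gt0 rad_le_K. Qed.

(** [mass_le] and [n <= m] bound [n * (K %/ rad)] by 4 m, and 31 = 6 * 4 + 7. *)
Lemma rounds_le : rounds * n <= 31 * m.
Proof.
have h1 := mass_le w loopE; have h2 := leq_trunc_div K rad.
have h3 : n * (K %/ rad) <= 4 * m.
  rewrite -(leq_pmul2r rad_gt0) -mulnA.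
  apply: (@leq_trans (n * K)); first by rewrite leq_mul2l h2 orbT.
  apply: leq_trans h1 _; rewrite leq_mul2r; apply/orP; right; lia.
rewrite /rounds mulnDl -mulnA [_ %/ _ * _]mulnC; move: h3 m_ge_n; move: (n * _)%N => t; lia.
Qed.

Section Reals.
Local Open Scope ring_scope.

(** A drawn root is good with probability at least rad / K, and the oracle then succeeds with
    probability at least 1/2. *)
Definition hit : R := rad%:R / (2 * K%:R).
(** The bound of [root_size_mean] on the mean size of the query at a drawn root. *)
Definition mu : R := n%:R + 2 * m%:R * rad%:R / K%:R.

Let KR : 0 < K%:R :> R. Proof. by rewrite ltr0n. Qed.
Let radR : 0 < rad%:R :> R. Proof. by rewrite ltr0n. Qed.
Let radK : rad%:R <= K%:R :> R. Proof. by rewrite ler_nat. Qed.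
Let mR : 0 < m%:R :> R. Proof. by rewrite ltr0n; lia. Qed.

Let hitK : hit * K%:R = rad%:R / 2.
Proof. by rewrite /hit invfM mulrA mulfVK // gt_eqF. Qed.
Let muK : mu * K%:R = n%:R * K%:R + 2 * m%:R * rad%:R.
Proof. by rewrite /mu mulrDl mulfVK // gt_eqF. Qed.

Lemma hit_gt0 : 0 < hit.
Proof. by rewrite divr_gt0 // mulr_gt0. Qed.

Lemma hit_le1 : hit <= 1.
Proof.
rewrite ler_pdivrMr ?mulr_gt0 //; move: KR radK; move: K%:R rad%:R => k r hk hr; lra.
Qed.

Lemma mu_ge0 : 0 <= mu.
Proof. by rewrite addr_ge0 // divr_ge0 // !mulr_ge0. Qed.

(** An upper bound on the probability that a query at [x] yields no good enough cut. *)
Definition missing (x : node) : R := if good c0 x then 2^-1 else 1.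

Lemma missing_mean : \sum_(x : node) (aw E w x.2)%:R * missing x <= K%:R * (1 - hit).
Proof.
have -> : \sum_(x : node) (aw E w x.2)%:R * missing x =
    K%:R - 2^-1 * (\sum_(x | good c0 x) aw E w x.2)%:R :> R.
  rewrite /mass !natr_sum mulr_sumr [X in _ - X]big_mkcond -sumrB.
  by apply: eq_bigr => x _; rewrite /missing; case: ifP => _; lra.
rewrite mulrBr mulr1 [_ * hit]mulrC hitK lerD2l lerN2 mulrC.
by rewrite ler_pM2l ?invr_gt0 // ler_nat mass_good.
Qed.

Lemma size_mean : \sum_(x : node) (aw E w x.2)%:R * (g x)%:R <= K%:R * mu.
Proof.
rewrite [_ * mu]mulrC muK.
under eq_bigr do rewrite -natrM.
rewrite -natr_sum; have := root_size_mean w loopE.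
by rewrite -(ler_nat R) natrD !natrM => h; rewrite [n%:R * _]mulrC.
Qed.

(** Markov's bound: the expected final count, with [j] draws to come, divided by the budget. *)
Definition over (j U : nat) : R := (U%:R + j%:R * mu) / (300 * m)%:R.

Lemma over_ge0 j U : 0 <= over j U.
Proof. by rewrite divr_ge0 // addr_ge0 // mulr_ge0 // mu_ge0. Qed.

(* Lower bounds on the probability of success with j rounds to go, after
   having used U units of the budget: [value] when the next root x is known,
   [avalue] when it is still to be drawn.  The Boolean tells whether the best
   cut so far is already good enough. *)
Definition avalue (j : nat) (ok : bool) (U : nat) : R :=
  if ok then 1 else Num.max 0 (1 - (1 - hit) ^+ j - over j U).

Definition value (j : nat) (ok : bool) (U : nat) (x : node) : R :=
  if ok then 1 else
  if j is j'.+1 then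
    Num.max 0 (1 - missing x * (1 - hit) ^+ j' - over j' (U + g x))
  else 0.

Lemma hit_pow_ge0 j : 0 <= (1 - hit) ^+ j.
Proof. by rewrite exprn_ge0 // subr_ge0 hit_le1. Qed.

Lemma avalue_bounds j ok U : 0 <= avalue j ok U <= 1.
Proof.
rewrite /avalue; case: ok; first by rewrite ler01 lexx.
rewrite le_max lexx /= ge_max ler01 /=.
by have := hit_pow_ge0 j; have := over_ge0 j U; lra.
Qed.

Lemma value_ge0 j ok U x : 0 <= value j ok U x.
Proof. by rewrite /value; case: ok => //; case: j => // j; rewrite le_max lexx. Qed.

(** Since [over] is affine in the count, averaging over the root replaces its size by at most [mu],
    that is, one more draw in [over]; averaging [missing] yields at most 1 - [hit], one more factor
    in the power. *)
Lemma avalue_mean j ok U :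
  avalue j ok U <= \sum_(x : node) (aw E w x.2)%:R / K%:R * value j ok U x.
Proof.
have sum1 : \sum_(x : node) (aw E w x.2)%:R / K%:R = 1 :> R.
  by rewrite -mulr_suml -natr_sum divff // gt_eqF.
have ge0 : 0 <= \sum_(x : node) (aw E w x.2)%:R / K%:R * value j ok U x.
  by apply: sumr_ge0 => x _; rewrite mulr_ge0 ?divr_ge0 // value_ge0.
rewrite {1}/avalue; case: ok ge0 => ge0.
  by rewrite /value; under eq_bigr do rewrite mulr1; rewrite sum1.
rewrite ge_max ge0 /=; case: j ge0 => [|j] ge0.
  by apply: le_trans ge0; rewrite expr0; have := over_ge0 0 U; lra.
have mR0 : (300 * m)%:R != 0 :> R by rewrite natrM mulf_neq0 // gt_eqF.
apply: (@le_trans _ _ (\sum_(x : node) (aw E w x.2)%:R / K%:R *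
    (1 - missing x * (1 - hit) ^+ j - over j (U + g x)))); last first.
  by apply: ler_sum => x _; rewrite ler_wpM2l ?divr_ge0 // le_max lexx orbT.
have pt (x : node) : (aw E w x.2)%:R / K%:R *
    (1 - missing x * (1 - hit) ^+ j - over j (U + g x)) =
    (aw E w x.2)%:R / K%:R * (1 - over j U)
    - (aw E w x.2)%:R * missing x * (K%:R^-1 * (1 - hit) ^+ j)
    - (aw E w x.2)%:R * (g x)%:R * (K%:R^-1 / (300 * m)%:R).
  by rewrite /over natrD; ring.
rewrite (eq_bigr _ (fun x _ => pt x)) 2!sumrB -mulr_suml sum1 mul1r -!mulr_suml !mulrA.
have e : over j.+1 U = over j U + mu / (300 * m)%:R.
  by rewrite /over -natr1; ring.
rewrite e exprS.
have h1 : (\sum_(x : node) (aw E w x.2)%:R * missing x) / K%:R <= 1 - hit.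
  by rewrite ler_pdivrMr // mulrC missing_mean.
have h2 : (\sum_(x : node) (aw E w x.2)%:R * (g x)%:R) / K%:R / (300 * m)%:R
    <= mu / (300 * m)%:R.
  by rewrite ler_wpM2r ?invr_ge0 // ler_pdivrMr // mulrC size_mean.
have h3 := ler_wpM2r (hit_pow_ge0 j) h1.
by lra.
Qed.

Lemma good_nin_lt x : good c0 x -> (#|nin x| < n.-1)%N.
Proof.
move=> hg; have := good_cut c0_cut hg.
move=> /andP [/vertex_cutP [h hL hR hE] hy].
have [u hu] := set0Pn _ hL.
rewrite rest_neq0 //; apply/set0Pn; exists u.
have := hE _ _ hu hy; rewrite !inE /= eqxx andbT negb_or => ->; rewrite andbT.
by apply/eqP => e; have := h u; rewrite hu e hy; case: (_ \in _).
Qed.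

(** Beyond the budget [over] is at least 1 and the claim is void. A root with every other vertex as
    in-neighbour is not good, so [missing] is 1 and nothing is lost by skipping it. *)
Lemma value_skip j ok U x :
  ((300 * m < U + g x) || ~~ (#|nin x| < n.-1))%N ->
  value j.+1 ok U x <= avalue j ok (U + g x).
Proof.
have /andP [a0 _] := avalue_bounds j ok (U + g x).
rewrite /value /avalue; case: ok a0 => // a0 /orP [hU | hx].
  apply: le_trans (a0); rewrite ge_max lexx /=.
  have : 1 <= over j (U + g x).
    rewrite ler_pdivlMr ?mul1r; last by rewrite natrM mulr_gt0.
    apply: (@le_trans _ _ (U + g x)%:R); first by rewrite ler_nat ltnW.
    by rewrite lerDl mulr_ge0 // mu_ge0.
  have : 0 <= missing x * (1 - hit) ^+ j.
    by rewrite mulr_ge0 ?hit_pow_ge0 // /missing; case: ifP => _ //; rewrite invr_ge0.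
  by lra.
have -> : missing x = 1.
  by rewrite /missing; case: ifP => // /good_nin_lt h; rewrite h in hx.
by rewrite mul1r.
Qed.

(** With A the value after a failure and p the probability of a good answer, the mean is A + (1 - A)
    p. For p at least 1/2 this is at least (1 + A) / 2, which halves the missing term. *)
Lemma value_query j ok U x (P : triple n -> bool) (pr : triple n -> R) :
  (forall c, 0 <= pr c) -> \sum_c pr c = 1 ->
  (good c0 x -> 1 / 2 <= \sum_(c | P c) pr c) ->
  value j.+1 ok U x <= \sum_c pr c * avalue j (ok || P c) (U + g x).
Proof.
move=> h0 h1 hP; rewrite /value; case: ok => /=.
  by rewrite /avalue; under eq_bigr do rewrite mulr1; rewrite h1.
set A := avalue j false (U + g x).
have /andP [A0 A1] := avalue_bounds j false (U + g x); rewrite -/A in A0 A1.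
have -> : \sum_c pr c * avalue j (P c) (U + g x) = A + (1 - A) * \sum_(c | P c) pr c.
  rewrite -[X in X + _]mul1r -{1}h1 mulr_suml mulr_sumr [X in _ + X]big_mkcond.
  rewrite -big_split /=; apply: eq_bigr => c _; case: (P c); last by rewrite addr0.
  by rewrite {1}/avalue; ring.
have S0 : 0 <= \sum_(c | P c) pr c by apply: sumr_ge0.
have hA : 1 - (1 - hit) ^+ j - over j (U + g x) <= A.
  by rewrite /A /avalue le_max lexx orbT.
have o0 := over_ge0 j (U + g x); have q0 := hit_pow_ge0 j.
have A1' : 0 <= 1 - A by lra.
rewrite ge_max; apply/andP; split.
  by rewrite addr_ge0 // mulr_ge0.
rewrite /missing; case: ifP => [/hP h | _]; last first.
  by apply: (@le_trans _ _ A); [lra | rewrite lerDl mulr_ge0].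
have := ler_wpM2l A1' h; lra.
Qed.

(** The bound of (1 - p)^k by 1 / (1 + k p), stated without division. *)
Lemma bernoulli (p : R) k : 0 <= p -> p <= 1 -> (1 - p) ^+ k * (1 + k%:R * p) <= 1.
Proof.
move=> p0 p1; elim: k => [|k IH]; first by rewrite expr0 mul1r mul0r addr0.
apply: le_trans IH; rewrite exprS -mulrA mulrCA.
apply: ler_wpM2l; first by rewrite exprn_ge0 // subr_ge0.
have -> : (1 - p) * (1 + k.+1%:R * p) = 1 + k%:R * p - (k%:R * p * p + p * p).
  by rewrite -natr1; ring.
by rewrite gerBl addr_ge0 // !mulr_ge0.
Qed.

Lemma value_start ok x : 1 / 2 <= value rounds ok 0 x.
Proof.
rewrite /value; case: ok; first by lra.
rewrite /rounds addnS.
set k := (6 * _ + 6)%N.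
have hk1 : 6 * K%:R <= k%:R * rad%:R :> R.
  by rewrite -!natrM ler_nat; have /andP [] := six_div rad_gt0 rad_le_K.
have hk2 : k%:R * rad%:R <= 12 * K%:R :> R.
  by rewrite -!natrM ler_nat; have /andP [] := six_div rad_gt0 rad_le_K.
clearbody k.
have mn : n%:R <= m%:R :> R by rewrite ler_nat.
(* Six times the mass over the radius, times [hit], is 3, and 1 / (1 + 3) = 1/4. *)
have hq : (1 - hit) ^+ k <= 1 / 4.
  have h3 : 3 <= k%:R * hit.
    rewrite -(ler_pM2r KR) -mulrA hitK; lra.
  have := bernoulli k (ltW hit_gt0) hit_le1.
  have : (1 - hit) ^+ k * 4 <= (1 - hit) ^+ k * (1 + k%:R * hit).
    by apply: ler_wpM2l; [exact: hit_pow_ge0 | lra].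
  by lra.
(* By [mass_le] and [n <= m], [mu] is at most 6 m rad / K, and [k] is at most 12 K / rad. *)
have hmu : k%:R * mu <= 72 * m%:R.
  have h1 : mu * rad%:R * K%:R <= 6 * m%:R * rad%:R * rad%:R.
    have := mass_le w loopE; rewrite -(ler_nat R) !natrM natrD => h.
    rewrite mulrAC muK ler_pM2r //.
    have : n%:R * rad%:R <= m%:R * rad%:R :> R by rewrite ler_pM2r.
    by lra.
  rewrite -(ler_pM2r radR) -(ler_pM2r KR).
  have h2 := ler_wpM2l (ler0n R k) h1.
  have h4 := ler_wpM2r (mulr_ge0 (mulr_ge0 (ler0n R 6) (ltW mR)) (ltW radR)) hk2.
  move: h2 h4; move: K%:R rad%:R m%:R k%:R mu => K' r' m' k' mu' h2 h4; lra.
(* The first root is not drawn, but its query has at most n + m <= 2 m edges; 72 m + 2 m stays below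
   75 m, a quarter of the budget. *)
have ho : over k (0 + g x) <= 1 / 4.
  have gx : (g x)%:R <= 2 * m%:R :> R.
    rewrite -natrM ler_nat mul2n -addnn.
    by apply: leq_trans (root_size_le E x) _; rewrite leq_add2r.
  rewrite /over add0n natrM ler_pdivrMr; last by rewrite mulr_gt0.
  by move: gx hmu mR; move: (g x)%:R (k%:R * mu) m%:R => a1 a2 a3; lra.
rewrite le_max; apply/orP; right.
have : missing x * (1 - hit) ^+ k <= (1 - hit) ^+ k.
  rewrite -[leRHS]mul1r ler_wpM2r ?hit_pow_ge0 // /missing; case: ifP => _; lra.
by lra.
Qed.

End Reals.

(** * The main loop *)

Definition outp (a : store) : triple n :=
  ([set u : 'I_n | a rout u == 0], [set u : 'I_n | a rout u == 1],
   [set u : 'I_n | a rout u == 2]).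

Lemma outp_label c (a : store) : vertex_cut E c ->
  (forall u : 'I_n, a rout u = label c u) -> outp a = c.
Proof. exact: (@output_label c (State id a 0 0 0)). Qed.

Lemma outp_ext (a a' : store) :
  (forall u : 'I_n, a' rout u = a rout u) -> outp a' = outp a.
Proof. by move=> h; congr (_, _, _); apply/setP => u; rewrite !inE h. Qed.

Definition static (v : env) (a : store) : Prop :=
  [/\ v xn = n, v xm = m, v xmass = K & v xN = rounds] /\
  [/\ forall u : 'I_n, a rw u = w u, represents a (nbrs es)
    & forall x, a raw (code x) = aw E w x.2].

Lemma static_agree xs rs v a v' a' : agree xs rs v a v' a' ->
  all (fun x => x \notin xs) [:: xn; xm; xmass; xN] ->
  all (fun r => r \notin rs) [:: rw; rdeg; rnb; rmat; riw; raw] ->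
  static v a -> static v' a'.
Proof.
move=> [hv ha] /and5P [h1 h2 h3 h4 _] /and5P [k1 k2 k3 k4 /and3P [k5 k6 _]].
move=> [[e1 e2 e3 e4] [hw hr haw]]; split; first by split; rewrite hv.
split=> [u | x | x]; try by rewrite ha.
by have [d1 d2 d3 d4] := hr x; split=> [| j u hj | u |]; rewrite ha //; exact: d2.
Qed.

Definition ok_cut (k : nat) : bool := (k%:R <= (1 + eps) * (OPT w E)%:R)%R.

Definition valid (v : env) (a : store) : Prop :=
  vertex_cut E (outp a) /\ cut_weight w (outp a) = v xbw.

Variable S0 : nat.

(** The state before round [i], with next root [x]; the right disjunct is the first round, where no
    cut is recorded yet. Apart from 5 steps per queried edge, a round takes at most 18 n + 20 steps
    up to the redraw (see [mid]) and 6 n + 4 for it, together at most 36 n because n >= 2. *)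
Definition inv (i : nat) (x : node) (v : env) (a : store) (st qc qe : nat) : Prop :=
  [/\ static v a, v xi = i, v xz = code x &
      valid v a \/ [/\ v xbw = wsum w, #|nin x| < n.-1, v xU = 0 & i = 0]] /\
  [/\ st <= S0 + i * (36 * n) + 5 * qe, qc <= i, qe <= v xU, qe <= 300 * m
    & v xU <= i * (n + m)].

Definition mid (i : nat) (v : env) (a : store) (st qc qe : nat) : Prop :=
  [/\ static v a, v xi = i & valid v a] /\
  [/\ st <= S0 + i * (36 * n) + (18 * n + 20) + 5 * qe, qc <= i.+1, qe <= v xU,
      qe <= 300 * m & v xU <= i.+1 * (n + m)].

Definition final (s : state) : Prop :=
  [/\ vertex_cut E (output n s), queries s <= rounds, query_edges s <= 300 * m
    & steps s <= S0 + rounds * (36 * n) + 1500 * m + 1].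

Definition success (s : state) : bool := ok_cut (cut_weight w (output n s)).

Notation H := (holds b eps Orc final success).

Lemma rounds_small : rounds * (n + m) < 2 ^ b.
Proof.
have h1 : K %/ rad <= 2 * wsum w.
  exact: leq_trans (leq_div _ _) mass_le_wsum.
apply: leq_ltn_trans b_large; rewrite -mulnA; apply: leq_mul.
  by rewrite /rounds; move: h1; move: (K %/ rad) => t; lia.
by rewrite -[leqLHS]mul1n; apply: leq_mul => //; exact: leqnSn.
Qed.

(** Both branches of a round end with this step; the behaviour of the following rounds is a
    hypothesis, which the induction in [loop_spec] supplies. *)
Lemma redraw_spec j i v a st qc qe : i < rounds ->
  (forall x v' a' st' qc' qe', inv i.+1 x v' a' st' qc' qe' ->
     H [:: main_loop] (State v' a' st' qc' qe') (value j (ok_cut (v' xbw)) (v' xU) x)) ->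
  mid i v a st qc qe ->
  H [:: redraw; main_loop] (State v a st qc qe) (avalue j (ok_cut (v xbw)) (v xU)).
Proof.
move=> hi IH [[hst hvi hval] [h1 h2 h3 h4 h5]].
have [[e1 e2 e3 e4] [hw hr haw]] := hst.
have hir : i.+1 < 2 ^ b.
  apply: leq_ltn_trans rounds_small; apply: leq_trans hi _.
  by rewrite leq_pmulr //; lia.
pose x0 : node := (false, Ordinal (ltnW n_gt1)).
have hnd k : k < 2 * n -> code (nth x0 nodes k) = k.
  by move=> hk; have [x <-] := code_surj hk; rewrite nth_nodes.
have sw : size weights = 2 * n by rewrite size_map size_nodes.
apply: holds_seq; apply: (@holds_rand _ _ _ _ _ _ _ _ _ _ _ _ _ _ _ K
  (fun r => value j (ok_cut (v xbw)) (v xU) (nth x0 nodes (wpick weights r)))) => //.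
- move=> r.
  have hlt : wpick weights r < 2 * n by rewrite -sw; apply: wpick_lt; rewrite sumn_weights.
  apply: holds_seq; apply: holds_det.
    by apply: tri_frame; apply: (@pick_spec (upd v xr r) a) => //=; exact: ltn_ord.
  move=> v1 a1 t1 ht1 [hz1 fr1]; have [hv1 ha1] := fr1.
  apply: holds_det.
    apply: (@tri_assign _ _ _ _ _ _ _ _ _ 0
      (fun v' a' => v' = upd v1 xi i.+1 /\ a' = a1)).
    by split=> //; rewrite evE /= hv1 //= hvi ?addn1 //; split=> //; lia.
  move=> v2 a2 t2 ht2 [-> ->].
  have eb : upd v1 xi i.+1 xbw = v xbw by rewrite /= hv1.
  have eU : upd v1 xi i.+1 xU = v xU by rewrite /= hv1.
  rewrite -eb -eU; apply: IH; split.
    split=> //=.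
    + have /static_agree : agree [:: xz; xr; xi] [::] v a (upd v1 xi i.+1) a1.
        split=> [y /= hy | y _ k]; last by rewrite ha1.
        have [hyi hy'] : (y == xi) = false /\ (y == xr) = false.
          by move: hy; rewrite !inE !negb_or => /and3P [_ /negPf -> /negPf ->].
        rewrite hyi hv1 /= ?hy' //; move: hy; rewrite !inE !negb_or => /and3P [-> -> _].
        by [].
      by apply.
    + by rewrite hz1 hnd.
    + left; case: hval => hc hcw; rewrite /valid /= hv1 //= (outp_ext (a := a)) // => u.
      by rewrite ha1.
  rewrite /= hv1 //=; split=> //; lia.
- rewrite -mulr_sumr (pick_mean (fun k => value j (ok_cut (v xbw)) (v xU) (nth x0 nodes k))).
  rewrite mulr_sumr; apply: le_trans (avalue_mean _ _ _) _.
  by apply: ler_sum => x _; rewrite nth_nodes mulrA [(_ / _)%R]mulrC.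
Qed.

(** L is nonempty and weights are positive. Hence the first answer beats the initial best weight
    w(V) and is recorded. *)
Lemma cut_lt_wsum d c : vertex_cut (dirE E d) c -> cut_weight w c < wsum w.
Proof.
move=> /vertex_cutP [h hL _ _]; have [u hu] := set0Pn _ hL.
have nS : u \notin Spart c by have := h u; rewrite hu; case: (_ \in Spart c).
rewrite /wsum (bigD1 u) //= -[ltnLHS]add0n /cut_weight.
apply: (@leq_ltn_trans (0 + \sum_(v | v != u) w v)); last by rewrite ltn_add2r.
rewrite !add0n big_mkcond [leqRHS]big_mkcond; apply: leq_sum => v _.
by case: ifP => // hv; case: eqP => // e; rewrite -e hv in nS.
Qed.

Lemma root_graph_loopless x : loopless (root_graph E x).
Proof. by apply/forallP => v; rewrite inE dirE_loop. Qed.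

Lemma loop_spec j i x v a st qc qe : j + i = rounds -> inv i x v a st qc qe ->
  H [:: main_loop] (State v a st qc qe) (value j (ok_cut (v xbw)) (v xU) x).
Proof.
elim: j i x v a st qc qe => [|j IH] i x v a st qc qe hji
    [[hst hvi hvz hval] [h1 h2 h3 h4 h5]];
  have [[e1 e2 e3 e4] [hw hr haw]] := hst.
  rewrite add0n in hji.
  apply: holds_while_false.
    by rewrite evE /= hvi e4 hji ltnn //; split=> //; lia.
  have [hc hcw] : valid v a.
    by case: hval => // -[_ _ _ hi0]; move: hji; rewrite hi0 /rounds addnS.
  apply: holds_nil.
    split=> //=; rewrite -hji //.
    by move: h1 h4; move: (S0 + _) #|E| => s1 m1; lia.
  rewrite /value /success -[output _ _]/(outp a) hcw.
  by case: ifP.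
have hi : i < rounds by lia.
have hgx := root_size_le E x.
have hUb : v xU + g x < 2 ^ b.
  apply: leq_ltn_trans rounds_small.
  apply: (@leq_trans (i.+1 * (n + m))); last by rewrite leq_mul2r hi orbT.
  by rewrite mulSn addnC; apply: leq_add.
apply: holds_while_true.
  by rewrite evE /= hvi e4 hi //; split=> //; lia.
apply: holds_seq; apply: holds_det.
  by apply: tri_frame; apply: (count_edges_spec (x := x)).
move=> v1 a1 t1 ht1 [[hd hy ho hU] fr1]; have [hv1 ha1] := fr1.
have hst1 : static v1 a1 by apply: static_agree fr1 _ _ hst.
have [[f1 f2 f3 f4] [gw gr gaw]] := hst1.
have hz1 : v1 xz = code x by rewrite hv1.
have hbw1 : v1 xbw = v xbw by rewrite hv1.
have hout1 : outp a1 = outp a by apply: outp_ext => u; rewrite ha1.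
have IH' := IH i.+1; rewrite addSnnS in hji.
have hU1 : v1 xU <= i.+1 * (n + m).
  by rewrite hU mulSn addnC; apply: leq_add.
have hbb (p q : bool) : p * q < 2 ^ b by apply: leq_ltn_trans X1000; case: p; case: q.
apply: holds_seq; apply: holds_if; rewrite evE /=.
- move=> hcond.
  have [hUT hnx] : v1 xU <= 300 * m /\ #|nin x| < n.-1.
    move: hcond; rewrite hz1 (repr_deg x gr) f1 f2 subn1 addn1 ltnS.
    by case: (v1 14 <= _); case: (#|nin x| < _).
  apply: holds_seq; apply: holds_det.
    by apply: tri_frame; apply: (emit_spec (x := x)).
  move=> v2 a2 t2 ht2 [[hk2 hl2] fr2]; have [hv2 ha2] := fr2.
  have hst2 : static v2 a2 by apply: static_agree fr2 _ _ hst1.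
  have hbw2 : v2 xbw = v xbw by rewrite hv2.
  have hout2 : outp a2 = outp a by rewrite -hout1; apply: outp_ext => u; rewrite ha2.
  have hlg := arcs_graph x.
  have exr : exists c, rooted_cut (root_graph E x) x.2 c.
    have /andP [hsc hsy] := star_cutP loopE hnx.
    by exists (star_cut E x); apply: cut_root_graph.
  have [o0 o1 o2 o3] := orcP (root_graph_loopless x) exr.
  apply: holds_seq.
  apply: (@holds_query _ _ _ _ _ _ _ _ _ _ _ _ _ _ _ _ _ _ (g x) x.2 (arcs x)
    (fun c => avalue j (ok_cut (v xbw) || ok_cut (cut_weight w c)) (v xU + g x))).
  + by rewrite /ev /= hk2.
  + by rewrite /ev /= hv2.
  + exact: hl2.
  + exact: arcs_legal.
  + by rewrite hlg.
  + by rewrite hlg.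
  + rewrite hlg => c hc; have hrc := root_graph_cut (o2 c hc).
    rewrite /tick /count_query /write_triple /=.
    set a3 := (fun a' i => _).
    have hans (u : 'I_n) : a3 rans u = label c u by rewrite /a3 /= valK.
    have ha3 r k : r != rans -> a3 r k = a2 r k by rewrite /a3 => /negPf ->.
    have hst3 : static v2 a3.
      have /static_agree : agree [::] [:: rans] v2 a2 v2 a3.
        by split=> // r hr' k; apply: ha3; rewrite inE in hr'.
      by apply.
    have [[p1 p2 p3 p4] [qw qr qaw]] := hst3.
    apply: holds_det.
      apply: tri_frame; apply: (keep_spec (d := x.1) (c := c)) => //.
      by rewrite hv2.
    move=> v4 a4 t4 ht4 [hkeep fr4]; have [hv4 ha4] := fr4.
    have hU4 : v4 xU = v xU + g x by rewrite hv4 // hv2.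
    (* [keep] retains the smaller weight, and [ok_cut] is inherited by smaller weights. *)
    have hok : ok_cut (v xbw) || ok_cut (cut_weight w c) = ok_cut (v4 xbw).
      move: hkeep; rewrite hbw2; case: ltnP => hlt [-> _].
        rewrite orb_idl // /ok_cut => hh; apply: le_trans hh.
        by rewrite ler_nat ltnW.
      rewrite orb_idr // /ok_cut => hh; apply: le_trans hh.
      by rewrite ler_nat.
    rewrite hok -hU4; apply: (redraw_spec (i := i)) => //.
      by move=> x' v' a' st' qc' qe'; apply: IH'.
    split.
      split; first by apply: static_agree fr4 _ _ hst3.
        by rewrite hv4 // hv2 // hv1.
      move: hkeep; rewrite hbw2; case: ltnP => hlt [hb4 ho4].
        have hcf : vertex_cut E (flip x.1 c) by rewrite -vertex_cut_flip.
        by rewrite /valid (outp_label hcf ho4) hb4 cut_weight_flip.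
      case: hval => [[hc1 hc2] | [hb _ _ _]].
        by rewrite /valid hb4 -hc2 (outp_ext (a := a2)) ?hout2.
      by have := cut_lt_wsum hrc; rewrite -hb ltnNge hlt.
    rewrite hU4; rewrite hU in hUT hU1; split=> //.
    * clear -ht1 ht2 ht4 h1; move: (S0 + i * _) h1 => s1 h1; lia.
    * by rewrite leq_add2r.
    * by apply: leq_trans hUT; rewrite leq_add2r.
  (* The oracle competes with the rooted optimum of [root_graph]. For a good root, the optimal cut
     [c0], flipped if necessary, is a rooted cut there, so this optimum is at most OPT. *)
  + rewrite hlg; apply: value_query => // hg; apply: le_trans o3 _.
    rewrite [X in (X <= _)%R]big_mkcond [X in (_ <= X)%R]big_mkcond.
    apply: ler_sum => c _; case: ifP => [hh | _]; last by case: ifP.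
    case: ifP => // /negP []; apply: le_trans hh _.
    rewrite ler_wpM2l ?addr_ge0 // ler_nat -c0_opt -(cut_weight_flip w x.1 c0).
    by apply: OPT_rooted_le; exact: good_cut.
- by rewrite f1 f2; repeat split=> //; try exact: hbb; lia.
- move=> hcond.
  have hskip : (300 * m < v xU + g x) || ~~ (#|nin x| < n.-1).
    move: hcond; rewrite hz1 (repr_deg x gr) f1 f2 subn1 addn1 ltnS -hU [300 * m < _]ltnNge.
    by case: (v1 14 <= _); case: (#|nin x| < _).
  apply: holds_le (value_skip j _ hskip) _; rewrite -hU -hbw1.
  apply: holds_det.
    by apply: (@tri_skip _ _ _ _ _ _ _ 0 (fun v' a' => v' = v1 /\ a' = a1)).
  move=> v2 a2 t2 ht2 [-> ->].
  apply: (redraw_spec (i := i)) => //.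
    by move=> x' v' a' st' qc' qe'; apply: IH'.
  split.
    split=> //; first by rewrite hv1.
    case: hval => [[hc1 hc2] | [_ hn0 hU0 hi0]]; first by rewrite /valid hout1 hbw1.
    (* The first round is never skipped: its root has a star cut, and its query fits in the
       budget. *)
    by move: hskip; rewrite hn0 orbF hU0 add0n; clear -hgx m_ge_n; lia.
  rewrite hU; rewrite hU in hU1; split=> //.
  - clear -ht1 ht2 h1; move: (S0 + i * _) h1 => s1 h1; lia.
  - exact: leqW.
  - exact: leq_trans (leq_addr _ _).
- by rewrite f1 f2; repeat split=> //; try exact: hbb; lia.
Qed.

Lemma dense_holds v (a : store) st : st + 27 * n + 8 <= S0 ->
  v xn = n -> v xm = m -> (forall x, x \in [:: xtot; xrad; xmass; xi; xU] -> v x = 0) ->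
  (forall u : 'I_n, a rw u = w u) -> represents a (nbrs es) -> (forall i, a raw i = 0) ->
  H [:: dense] (State v a st 0 0) (1 / 2)%R.
Proof.
move=> hS hn hm hz hw hr ha.
have rad_le : rad <= wsum w.
  by apply: leq_trans (radius_OPT w loopE) _; exact: leq_subr.
apply: holds_seq; apply: holds_det.
  by apply: tri_frame; apply: compute_total_spec => //; apply: hz.
move=> v1 a1 t1 ht1 [tot1 [hv1 ha1]].
have hr1 : represents a1 (nbrs es).
  move=> x; have [d1 d2 d3 d4] := hr x.
  by split=> [| j u hj | u |]; rewrite ha1 //; exact: d2.
apply: holds_seq; apply: holds_det.
  by apply: tri_frame; apply: compute_radius_spec => //; rewrite hv1 //; apply: hz.
move=> v2 a2 t2 ht2 [[rad2 [x hx hzx]] [hv2 ha2]].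
apply: holds_seq; apply: holds_det.
  apply: tri_frame; apply: compute_mass_spec => //.
  - by rewrite hv2 // hv1.
  - by rewrite hv2 // hv1 // hz.
  - by move=> u; rewrite ha2 // ha1.
  - by move=> i; rewrite ha2 // ha1.
move=> v3 a3 t3 ht3 [[mass3 aw3] [hv3 ha3]].
have rad3 : v3 xrad = rad by rewrite hv3.
have hdiv : K %/ rad <= 2 * wsum w.
  exact: leq_trans (leq_div _ _) mass_le_wsum.
have hKw := mass_le_wsum.
apply: holds_seq; apply: holds_det.
  apply: (@tri_assign _ _ _ _ _ _ _ _ _ 0 (fun v' a' => v' = upd v3 xN rounds /\ a' = a3)).
  split=> //; rewrite evE /= mass3 rad3 //.
  by move: hdiv Xt X1000; move: (K %/ rad) => t hdiv hXt hX1; repeat split=> //; lia.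
move=> v4 a4 t4 ht4 [-> ->].
apply: holds_seq; apply: holds_det.
  apply: (@tri_assign _ _ _ _ _ _ _ _ _ 0 (fun v' a' =>
    v' = upd (upd v3 xN rounds) xbw (wsum w) /\ a' = a3)).
  by split=> //; rewrite /ev /= hv3 // hv2 // tot1.
move=> v5 a5 t5 ht5 [-> ->].
set v6 := upd _ _ _.
have eU : v6 xU = 0 by rewrite /v6 /= hv3 // hv2 // hv1 // hz.
apply: (holds_le (r := value rounds (ok_cut (v6 xbw)) (v6 xU) x)).
  by rewrite eU; exact: value_start.
apply: (loop_spec (i := 0)); first by rewrite addn0.
split.
  split=> //.
  - split; first by split=> //; rewrite /v6 /= hv3 // hv2 // hv1.
    split=> // [u | y]; first by rewrite ha3 // ha2 // ha1.
    have [d1 d2 d3 d4] := hr1 y.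
    by split=> [| j u hj | u |]; rewrite ha3 // ha2 //; exact: d2.
  - by rewrite /v6 /= hv3 // hv2 // hv1 // hz.
  - by rewrite /v6 /= hv3.
  - by right; split.
split=> //; last by rewrite eU.
by clear -hS ht1 ht2 ht3 ht4 ht5; lia.
Qed.

End Verify.

(** For B = 2 ^ (log n + log W + 1), which is at least 4, the four factors are at most B^5, B^2, B
    and B^2, whereas the words range up to B^20. *)
Lemma word_large n W (w : 'I_n -> nat) (E : edges n) :
  1 < n -> 0 < W -> (forall v, w v <= W) ->
  1000 * (wsum w).+1 * n.+1 * (n + #|E|).+1 < 2 ^ word_bits 20 n W.
Proof.
move=> n1 W0 hw.
rewrite /word_bits [20 * _]mulnC expnM; set t := (_ + _ + 1); set B := 2 ^ t.
have t2 : 1 < t.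
  by rewrite /t addn1 ltnS; apply: leq_trans (leq_addr _ _); rewrite trunc_log_gt0.
have B4 : 4 <= B by rewrite (_ : 4 = 2 ^ 2) // leq_exp2l.
have nB : n < B.
  by apply: leq_trans (trunc_log_ltn n (isT : 1 < 2)) _; rewrite leq_exp2l // /t; lia.
have WB : W < B.
  by apply: leq_trans (trunc_log_ltn W (isT : 1 < 2)) _; rewrite leq_exp2l // /t; lia.
have mE : #|E| <= n * n.
  by apply: leq_trans (max_card _) _; rewrite card_prod card_ord.
have wB : (wsum w).+1 <= B ^ 2.
  have h1 : wsum w <= n * W.
    rewrite -[n in n * W](card_ord n) -sum_nat_const; exact: leq_sum.
  have h2 : n * W <= B.-1 * B.-1 by apply: leq_mul; lia.
  rewrite (_ : B ^ 2 = B * B) //; move: (leq_trans h1 h2) B4; case: (B) => // x /=.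
  by move: (wsum w) => s hs _; rewrite mulSn mulnS; lia.
have mB : (n + #|E|).+1 <= B ^ 2.
  have h2 : n.+1 * n.+1 <= B * B by apply: leq_mul.
  by rewrite (_ : B ^ 2 = B * B) //; apply: leq_trans h2; nia.
have kB : 1000 <= B ^ 5.
  by apply: (@leq_trans (4 ^ 5)) => //; rewrite leq_exp2r.
apply: (@leq_ltn_trans (B ^ 5 * B ^ 2 * B ^ 1 * B ^ 2)).
  by rewrite !leq_mul // expn1.
by rewrite -!expnD ltn_exp2l //; lia.
Qed.

Local Open Scope ring_scope.

Theorem theorem1p4 (R : realType) :
  exists (alg : cmd) (c Cq Ce Ct k : nat), (1 < c)%N /\
  forall (n W : nat) (E : {set 'I_n * 'I_n}) (w : 'I_n -> nat) (eps : R)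
         (Orc : oracle R n) (es : seq ('I_n * 'I_n)),
    loopless E ->
    (forall v, (0 < w v <= W)%N) ->
    (exists cut, vertex_cut E cut) ->
    0 <= eps ->
    rooted_mincut_oracle w eps Orc ->
    perm_eq es (enum E) ->
    exists fuel : nat,
      let run := exec (word_bits c n W) eps Orc fuel alg (init_state w W es) in
      always (fun o : option state =>
        if o is Some s then
          [/\ vertex_cut E (output n s),
              (queries s)%:R <= Cq%:R * (#|E|%:R / n%:R) :> R,
              (query_edges s <= Ce * #|E|)%N
            & (steps s <= soft_O_bound Ct k #|E| W)%N]
        else False) run /\
      1 / 2 <= Pr (fun o : option state =>
        if o is Some s then
          (cut_weight w (output n s))%:R <= (1 + eps) * (OPT w E)%:R :> R
        else false) run.
Proof.
(* The time is linear, hence the exponent 0: per edge, the rounds take 36 * 31 steps, the listing 5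
   * 300, the scan 14 and the preprocessing 27 (as n <= m), 2657 in all; 3000 also absorbs the
   additive constants. *)
exists algo, 20%N, 31%N, 300%N, 3000%N, 0%N; split=> //.
move=> n W E w eps Orc es loopE hw [cut hcut] eps0 orcP esE.
have [c0 hc0 ho0] := OPT_attained w hcut.
have w0 v : (0 < w v)%N by have /andP [] := hw v.
have /vertex_cutP [hp hL hR _] := hcut.
have [x hx] := set0Pn _ hL; have [y hy] := set0Pn _ hR.
have n1 : (1 < n)%N.
  have : x != y.
    apply: contraTneq hx => ->; have := hp y; rewrite hy.
    by case: (y \in Lpart _) => //; case: (y \in _).
  rewrite -val_eqE /=; have := ltn_ord x; have := ltn_ord y; lia.
have W0 : (0 < W)%N by have /andP [h1] := hw x; apply: leq_trans.
have big := word_large E n1 W0 (fun v => proj2 (andP (hw v))).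
set b := word_bits 20 n W in big *.
have sz : size es = #|E| by rewrite (perm_size esE) cardE.
pose Q s := [/\ vertex_cut E (output n s), (queries s * n <= 31 * #|E|)%N,
  (query_edges s <= 300 * #|E|)%N & (steps s <= 3000 * #|E|.+1)%N].
pose G s := ok_cut eps E w (cut_weight w (output n s)).
have [f [hQ hG]] : exists f,
    always (fun o => if o is Some s then Q s else False)
      (exec b eps Orc f algo (init_state w W es)) /\
    1 / 2 <= Pr (fun o => if o is Some s then G s else false)
      (exec b eps Orc f algo (init_state w W es)).
  apply: holds_exec; apply: holds_seq; rewrite /init_state.
  set v0 := nth _ _; set a0 := (fun a => _).
  have in0 : input E w es v0 a0.
    split=> [||u|i e0 hi|i e0 hi]; rewrite /v0 /a0 //=.
    - by rewrite (nth_map u) ?size_enum_ord // nth_ord_enum.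
    - by rewrite (nth_map e0) ?sz.
    - by rewrite (nth_map e0) ?sz.
  have a00 r : (3 <= r)%N -> forall i, a0 r i = 0%N.
    by move=> hr i; rewrite /a0 [nth [::] _ r]nth_default // nth_nil.
  have scanP := @scan_spec R n b eps Orc E w es loopE esE n1 big v0 a0 in0 a00.
  apply: holds_det; first exact: tri_frame scanP.
  move=> v1 a1 t1 ht1 [hr1 [hv1 ha1]].
  have [i0 i1 i2 _ _] := in0.
  have vn : v1 0%N = n by rewrite hv1.
  have vm : v1 1%N = #|E| by rewrite hv1.
  have mE : (#|E| <= n * n)%N.
    by apply: leq_trans (max_card _) _; rewrite card_prod card_ord.
  have ge : ev b eps v1 a1 (Bin Lt (Var 1) (Var 0)) = (#|E| < n)%N.
    rewrite evE /= vn vm //; split=> //.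
    by apply: leq_ltn_trans big; case: (_ < n)%N => //=; lia.
  apply: holds_if; rewrite ge => hmn.
    have {}hmn : (#|E| < n)%N by case: ltnP hmn.
    have vx : v1 6 = 0%N by rewrite hv1.
    have aout i : a1 3 i = 0%N by rewrite ha1 // a00.
    apply: (@sparse_holds R n b eps Orc E w es loopE esE n1 big Q G v1 a1 _ _ hmn vx hr1 aout).
    move=> s h1 h2 h3 h4 h5; split.
      by split; rewrite ?h3 ?h4 ?mul0n //; apply: leq_trans h5 _; lia.
    have -> : G s by rewrite /G /ok_cut h2 mulr_ge0 ?addr_ge0.
    by rewrite (_ : true%:R = 1 :> R) //; lra.
  have {}hmn : (n <= #|E|)%N by case: ltnP hmn.
  apply: holds_impl; last first.
    apply: (dense_holds loopE w0 esE n1 big eps0 orcP hmn hc0 ho0 (leqnn _)) => //.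
    - move=> z; rewrite !inE => /orP [/eqP -> | ]; first by rewrite hv1.
      by move=> /or4P [] /eqP ->; rewrite hv1.
    - by move=> u; rewrite ha1.
    - by move=> i; rewrite ha1 // a00.
  move=> s [h1 h2 h3 h4].
  have hrn := rounds_le loopE w0 esE n1 big eps0 hmn hc0 ho0.
  split=> //; first by apply: leq_trans hrn; rewrite leq_mul2r h2 orbT.
  apply: leq_trans h4 _; move: hrn ht1 hmn; move: (rounds E w) #|E| => N m hrn ht1 hmn.
  rewrite (_ : (N * (36 * n) = 36 * (N * n))%N); last by rewrite mulnCA.
  lia.
exists f; split; last by [].
apply: always_impl hQ => -[s|] // [h1 h2 h3 h4]; split=> //.
  rewrite mulrA ler_pdivlMr ?ltr0n ?(ltnW n1) // -!natrM ler_nat.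
  exact: h2.
rewrite /soft_O_bound expn0 muln1; apply: leq_trans h4 _.
by rewrite leq_pmulr.
Qed.
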